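(* Let $\Omega\subset\mathbb{C}$ be a simply connected domain and $L=i+\sqrt{-1}\,j\in\mathbb{H}_{\mathbb{C}}$. Let $X\colon\Omega\to\mathbb{R}^3$ be a polynomial (resp. rational) minimal surface in isothermal parametrization. Then there exist a complex quaternion valued polynomial $A\in\mathbb{H}_{\mathbb{C}}[z]$ and a complex polynomial $\lambda\in\mathbb{C}[z]$ (resp. a complex rational function $\lambda\in\mathbb{C}(z)$) such that, with the isotropic complex curve $$\Phi=\lambda\,A\,L\,A^c,$$ one has, for a fixed $z_0\in\Omega$ and some $\mathbf{c}\in\mathbb{R}^3$, $$X(u,v)=\mathbf{c}+\operatorname{Re}\Bigl(\int_{\gamma}\Phi(\omega)\,d\omega\Bigr),$$ where $\gamma$ is a simple curve in $\Omega$ from $z_0$ to $z=u+\sqrt{-1}\,v$. In the case of rational $\lambda$, all the residues of $\lambda ALA^c$ must be zero (so that the integral is rational).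
   Context: $\mathbb{H}_{\mathbb{C}}=\mathbb{H}\otimes_{\mathbb{R}}\mathbb{C}$ is the algebra of complex quaternions: elements are $z_0+z_1i+z_2j+z_3k$ with $z_\ell\in\mathbb{C}$, where $i^2=j^2=k^2=-1$, $ij=-ji=k$, and the complex imaginary unit $\sqrt{-1}$ is central (distinct from $i$). The conjugate is $(z_0+z_1i+z_2j+z_3k)^c=z_0-z_1i-z_2j-z_3k$. $\mathbb{H}_{\mathbb{C}}[z]$ is the ring of polynomials in an indeterminate $z$ commuting with the coefficients, i.e. expressions $A=A_0(z)+A_1(z)i+A_2(z)j+A_3(z)k$ with $A_\ell\in\mathbb{C}[z]$; $A^c=A_0-A_1i-A_2j-A_3k$. The element $ALA^c$ has zero scalar part, and vectorial complex quaternions $z_1i+z_2j+z_3k$ are identified with $(z_1,z_2,z_3)\in\mathbb{C}^3$. ''Isotropic'' means $\Phi_1^2+\Phi_2^2+\Phi_3^2\equiv0$. A smooth parametric surface $X=X(u,v)\colon\Omega\to\mathbb{R}^3$ ($\mathbb{C}\simeq\mathbb{R}^2$, $z=u+\sqrt{-1}\,v$) is isothermal if $\langle X_u,X_u\rangle=\langle X_v,X_v\rangle>0$ and $\langle X_u,X_v\rangle=0$; it is minimal if its mean curvature vanishes at every point; it is polynomial (resp. rational) if its three components are real polynomials (resp. real rational functions) in $u,v$. The rational function $\Phi$ is considered after cancelling common factors, and its residues are taken componentwise at all its poles in $\mathbb{C}$. *)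

(* Defs.v *)
From HB Require Import structures.
From mathcomp Require Import all_boot all_order all_algebra.
From mathcomp Require Import generic_quotient fraction polyXY.
From mathcomp.real_closed Require Import complex.
From mathcomp Require Import all_classical all_reals all_analysis.
From mathcomp Require Import ring.

Set Implicit Arguments.
Unset Strict Implicit.
Unset Printing Implicit Defensive.

Import Order.TTheory GRing.Theory Num.Theory.
Import numFieldNormedType.Exports.

Local Open Scope classical_set_scope.
Local Open Scope ring_scope.

(** [quat R[i]] is the algebra of complex quaternions: the imaginary unit of
    [R[i]] is a scalar, distinct from the quaternion unit in position [q1].
    Since the indeterminate commutes with the coefficients, [quat {poly R[i]}]
    is the ring of polynomials with complex quaternion coefficients. *)

Record quat (K : Type) := Quat { q0 : K; q1 : K; q2 : K; q3 : K }.

Section QuatChoice.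
Context {K : choiceType}.

Definition quat_to (x : quat K) : K * K * K * K := (q0 x, q1 x, q2 x, q3 x).
Definition quat_of (t : K * K * K * K) : quat K :=
  let: (a, b, c, d) := t in Quat a b c d.

Lemma quat_toK : cancel quat_to quat_of.
Proof. by case. Qed.

HB.instance Definition _ := Choice.copy (quat K) (can_type quat_toK).
End QuatChoice.

Section QuatRing.
Context {K : comNzRingType}.
Implicit Types x y z : quat K.

Definition quat_zero : quat K := Quat 0 0 0 0.
Definition quat_one : quat K := Quat 1 0 0 0.
Definition quat_opp x : quat K := Quat (- q0 x) (- q1 x) (- q2 x) (- q3 x).
Definition quat_add x y : quat K :=
  Quat (q0 x + q0 y) (q1 x + q1 y) (q2 x + q2 y) (q3 x + q3 y).

(* i^2 = j^2 = k^2 = -1, ij = -ji = k, jk = -kj = i, ki = -ik = j *)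
Definition quat_mul x y : quat K :=
  Quat (q0 x * q0 y - q1 x * q1 y - q2 x * q2 y - q3 x * q3 y)
       (q0 x * q1 y + q1 x * q0 y + q2 x * q3 y - q3 x * q2 y)
       (q0 x * q2 y - q1 x * q3 y + q2 x * q0 y + q3 x * q1 y)
       (q0 x * q3 y + q1 x * q2 y - q2 x * q1 y + q3 x * q0 y).

Definition quat_scale (a : K) x : quat K :=
  Quat (a * q0 x) (a * q1 x) (a * q2 x) (a * q3 x).

Lemma quat_addA : associative quat_add.
Proof. by move=> x y z; congr Quat; rewrite /= addrA. Qed.

Lemma quat_addC : commutative quat_add.
Proof. by move=> x y; congr Quat; rewrite /= addrC. Qed.

Lemma quat_add0 : left_id quat_zero quat_add.
Proof. by case=> *; congr Quat; rewrite /= add0r. Qed.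

Lemma quat_addN : left_inverse quat_zero quat_opp quat_add.
Proof. by move=> x; congr Quat; rewrite /= addNr. Qed.

HB.instance Definition _ := GRing.isZmodule.Build (quat K)
  quat_addA quat_addC quat_add0 quat_addN.

Lemma quat_mulA : associative quat_mul.
Proof. by move=> x y z; congr Quat => /=; ring. Qed.

Lemma quat_mul1l : left_id quat_one quat_mul.
Proof. by case=> *; congr Quat => /=; ring. Qed.

Lemma quat_mul1r : right_id quat_one quat_mul.
Proof. by case=> *; congr Quat => /=; ring. Qed.

Lemma quat_mulDl : left_distributive quat_mul quat_add.
Proof. by move=> x y z; congr Quat => /=; ring. Qed.

Lemma quat_mulDr : right_distributive quat_mul quat_add.
Proof. by move=> x y z; congr Quat => /=; ring. Qed.

Lemma quat_one_neq0 : quat_one != 0.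
Proof. by apply/eqP => /(congr1 (@q0 K)) /= /eqP; rewrite oner_eq0. Qed.

HB.instance Definition _ := GRing.Zmodule_isNzRing.Build (quat K)
  quat_mulA quat_mul1l quat_mul1r quat_mulDl quat_mulDr quat_one_neq0.

Lemma quat_scaleA a b x : quat_scale a (quat_scale b x) = quat_scale (a * b) x.
Proof. by congr Quat; rewrite /= mulrA. Qed.

Lemma quat_scale1 : left_id 1 quat_scale.
Proof. by case=> *; congr Quat; rewrite /= mul1r. Qed.

Lemma quat_scaleDr : right_distributive quat_scale +%R.
Proof. by move=> a x y; congr Quat; rewrite /= mulrDr. Qed.

Lemma quat_scaleDl x : {morph quat_scale^~ x : a b / a + b}.
Proof. by move=> a b; congr Quat; rewrite /= mulrDl. Qed.

HB.instance Definition _ := GRing.Zmodule_isLmodule.Build K (quat K)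
  quat_scaleA quat_scale1 quat_scaleDr quat_scaleDl.

Definition quat_conj x : quat K := Quat (q0 x) (- q1 x) (- q2 x) (- q3 x).

(* The identification of K^3 with the vectorial quaternions. *)
Definition quat_vec (w : 'rV[K]_3) : quat K :=
  Quat 0 (w ord0 0) (w ord0 1) (w ord0 2%:R).

End QuatRing.

Definition quat_map (K K' : Type) (f : K -> K') (x : quat K) : quat K' :=
  Quat (f (q0 x)) (f (q1 x)) (f (q2 x)) (f (q3 x)).

Definition isotropic (K : comNzRingType) (w : 'rV[K]_3) : Prop :=
  \sum_(l < 3) w ord0 l ^+ 2 = 0.

Section QuatL.
Context {R : rcfType}.

Definition quat_L : quat R[i] := Quat 0 1 (0 +i* 1)%C 0.

Definition ALAc (A : quat {poly R[i]}) : quat {poly R[i]} :=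
  A * quat_map polyC quat_L * quat_conj A.

End QuatL.

Section RationalFunctions.
Context {F : fieldType}.
Implicit Type f : {fraction {poly F}}.

(* Numerator and denominator after cancelling common factors; they are
   determined by [f] up to a common nonzero constant. *)
Definition ratf_num f : {poly F} :=
  (frac (repr f)).1 %/ gcdp (frac (repr f)).1 (frac (repr f)).2.
Definition ratf_den f : {poly F} :=
  (frac (repr f)).2 %/ gcdp (frac (repr f)).1 (frac (repr f)).2.

Definition ratf_pole f (a : F) : Prop := root (ratf_den f) a.

Definition ratf_eval f (a : F) : F := (ratf_num f).[a] / (ratf_den f).[a].

(* sum_k s_k / (z - a)^(k+1), so that the coefficient of 1 / (z - a) is s_0 *)
Definition principal_part (a : F) (s : seq F) : {fraction {poly F}} :=
  \sum_(k < size s) (tofrac (s`_k)%:P / tofrac ('X - a%:P) ^+ k.+1).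

(* [r] is the residue of [f] at [a]: removing from [f] the principal part of
   its Laurent expansion at [a] leaves a rational function without pole at
   [a], and [r] is the coefficient of 1 / (z - a). *)
Definition is_residue f (a r : F) : Prop :=
  exists s : seq F, ~ ratf_pole (f - principal_part a s) a /\ s`_0 = r.

End RationalFunctions.

(** The complex plane is R * R; [toC] gives the corresponding complex number.
    Curves are maps R -> R * R of which only the restriction to [0, 1]
    matters. *)

Section PlaneDomains.
Context {R : realType}.
Implicit Types (Omega : set (R * R)) (gamma : R -> R * R).

Definition toC (p : R * R) : R[i] := (p.1 +i* p.2)%C.

Definition domain Omega : Prop :=
  [/\ open Omega, connected Omega & Omega !=set0].

Definition curve_in Omega gamma : Prop :=
  {within `[0, 1], continuous gamma} /\ (forall t, t \in `[0, 1] -> Omega (gamma t)).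

(* Path connected, and every loop is homotopic in Omega, relatively to its
   base point, to a constant. *)
Definition simply_connected Omega : Prop :=
  (forall p q, Omega p -> Omega q ->
     exists gamma, [/\ curve_in Omega gamma, gamma 0 = p & gamma 1 = q]) /\
  (forall gamma, curve_in Omega gamma -> gamma 0 = gamma 1 ->
     exists H : R * R -> R * R,
       [/\ {within `[0, 1] `*` `[0, 1], continuous H},
           forall s t, s \in `[0, 1] -> t \in `[0, 1] -> Omega (H (s, t)),
           forall t, t \in `[0, 1] -> H (0, t) = gamma t,
           forall t, t \in `[0, 1] -> H (1, t) = gamma 0 &
           forall s, s \in `[0, 1] -> H (s, 0) = gamma 0 /\ H (s, 1) = gamma 0]).

(* C^1 up to the end points: the derivative on the open interval extends
   continuously to the closed one. *)
Definition C1_on (a b : R) gamma : Prop :=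
  exists g : R -> R * R,
    {within `[a, b], continuous g} /\
    (forall t, t \in `]a, b[ -> is_derive t 1 gamma (g t)).

(* The subdivision is 0 < s_0 < ... < s_(n-1) = 1. *)
Definition piecewise_C1 gamma : Prop :=
  {within `[0, 1], continuous gamma} /\
  exists s : seq R,
    [/\ path <%R 0 s, last 0 s = 1 &
        forall k, (k < size s)%N -> C1_on (0 :: s)`_k s`_k gamma].

(* Simple closed curves are allowed, so that the end points may coincide. *)
Definition simple gamma : Prop :=
  forall s t, s \in `[0, 1] -> t \in `[0, 1] -> s < t -> gamma s = gamma t ->
    s = 0 /\ t = 1.

Definition simple_curve Omega (p q : R * R) gamma : Prop :=
  [/\ piecewise_C1 gamma, simple gamma, curve_in Omega gamma,
      gamma 0 = p & gamma 1 = q].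

Definition contour_integral (f : R[i] -> R[i]) gamma : R[i] :=
  let h t := f (toC (gamma t)) * toC ('D_1 gamma t) in
  (Rintegral lebesgue_measure `[0, 1] (fun t => complex.Re (h t)) +i*
   Rintegral lebesgue_measure `[0, 1] (fun t => complex.Im (h t)))%C.

End PlaneDomains.

Section Surfaces.
Context {R : realType}.
Implicit Types (Omega : set (R * R)) (X : R * R -> 'rV[R]_3).

Definition dotp (x y : 'rV[R]_3) : R := \sum_(l < 3) x ord0 l * y ord0 l.

Definition crossp (x y : 'rV[R]_3) : 'rV[R]_3 :=
  \row_(l < 3) (x ord0 (l + 1) * y ord0 (l + 2%:R) -
                x ord0 (l + 2%:R) * y ord0 (l + 1)).

Definition norm2 (x : 'rV[R]_3) : R := Num.sqrt (dotp x x).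

Definition Du X : R * R -> 'rV[R]_3 := fun p => 'D_((1, 0) : R * R) X p.
Definition Dv X : R * R -> 'rV[R]_3 := fun p => 'D_((0, 1) : R * R) X p.

(* All iterated partial derivatives are (Frechet) differentiable on Omega; the
   list encodes the order of derivation. *)
Definition smooth_on Omega X : Prop :=
  forall (s : seq bool) p, Omega p ->
    differentiable (foldr (fun b Y => if b then Du Y else Dv Y) X s) p.

Definition isothermal Omega X : Prop :=
  forall p, Omega p ->
    [/\ dotp (Du X p) (Du X p) = dotp (Dv X p) (Dv X p),
        0 < dotp (Du X p) (Du X p) & dotp (Du X p) (Dv X p) = 0].

Definition unit_normal X p : 'rV[R]_3 :=
  (norm2 (crossp (Du X p) (Dv X p)))^-1 *: crossp (Du X p) (Dv X p).

(* (e G - 2 f F + g E) / (2 (E G - F^2)), in terms of the coefficients of the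
   first and second fundamental forms *)
Definition mean_curvature X p : R :=
  let E := dotp (Du X p) (Du X p) in
  let F := dotp (Du X p) (Dv X p) in
  let G := dotp (Dv X p) (Dv X p) in
  let e := dotp (Du (Du X) p) (unit_normal X p) in
  let f := dotp (Dv (Du X) p) (unit_normal X p) in
  let g := dotp (Dv (Dv X) p) (unit_normal X p) in
  (e * G - 2%:R * f * F + g * E) / (2%:R * (E * G - F ^+ 2)).

Definition minimal Omega X : Prop :=
  forall p, Omega p -> mean_curvature X p = 0.

(* Value at (u, v) of a real polynomial in two variables; the outer variable
   of {poly {poly R}} stands for u. *)
Definition eval2 (P : {poly {poly R}}) (p : R * R) : R := P.[p.1, p.2].

Definition polynomial_surface Omega X : Prop :=
  forall l : 'I_3, exists P : {poly {poly R}},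
    forall p, Omega p -> X p ord0 l = eval2 P p.

(* The denominator may vanish at some points of Omega: there, the value of the
   component is determined by the continuity of X. *)
Definition rational_surface Omega X : Prop :=
  forall l : 'I_3, exists P Q : {poly {poly R}},
    Q != 0 /\
    (forall p, Omega p -> eval2 Q p != 0 -> X p ord0 l = eval2 P p / eval2 Q p).

(* X = c + Re (integral of Phi), the integral being taken along any simple
   curve in Omega from the base point z0 *)
Definition real_part_of_integral Omega X (Phi : 'I_3 -> R[i] -> R[i]) : Prop :=
  forall z0, Omega z0 -> exists c : 'rV[R]_3,
    forall z gamma, Omega z -> simple_curve Omega z0 z gamma ->
      X z = c + \row_(l < 3) complex.Re (contour_integral (Phi l) gamma).

End Surfaces.

(* Main.v *)
(** In isothermal coordinates minimality means that [X] is harmonic, so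
    [Phi = X_u - i X_v] is holomorphic and isotropic, and [Re (Phi dz) = dX];
    the integral formula is then the fundamental theorem of calculus along the
    curve. If a component is a quotient [P / Q], the substitution
    [u = (z + w) / 2], [v = (z - w) / (2 i)] turns harmonicity into the
    vanishing of the mixed derivative in [z] and [w]; hence the component of
    [Phi] is a rational function of [z] alone, with the rational primitive
    obtained by freezing [w], which is why its residues vanish. Finally, with
    [g = Phi_1 - i Phi_2] and [Phi_3] written as [g = l s^2], [Phi_3 = l s t]
    for coprime [s], [t], isotropy forces [Phi_1 + i Phi_2 = - l t^2], and this
    is [- (l / 2) A L A^c] for [A = i s + t I], where [i] is the complex and
    [I] the quaternionic imaginary unit. *)

Require Import Defs.
From HB Require Import structures.
From mathcomp Require Import all_boot all_order all_algebra.
From mathcomp Require Import generic_quotient fraction polyXY.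
From mathcomp.real_closed Require Import complex.
From mathcomp Require Import all_classical all_reals all_analysis.
From mathcomp Require Import measurable_realfun.
From mathcomp Require Import ring lra.

Set Implicit Arguments.
Unset Strict Implicit.
Unset Printing Implicit Defensive.

Import Order.TTheory GRing.Theory Num.Theory.
Import numFieldNormedType.Exports.

Local Open Scope classical_set_scope.
Local Open Scope ring_scope.

(** * Factorization of isotropic polynomial curves *)

Section Isotropic.
Context {R : rcfType}.
Local Notation C := R[i].

(** Isotropy reads [g * (x + I * y) = - z ^+ 2]. For [m] the gcd of [g] and [z], coprimality of the
    cofactors [s] and [t] forces [s] to divide [m], whence [g = l s^2] and [z = l s t]. *)
Lemma isotropic_ALAc (w : 'rV[{poly C}]_3) : isotropic w ->
  exists (A : quat {poly C}) (lambda : {poly C}),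
    quat_vec w = lambda *: ALAc A.
Proof.
rewrite /isotropic !big_ord_recl big_ord0 /= addr0.
set x := w _ _; set y := w _ _; set z := w _ _ => iso.
have -> : quat_vec w = Quat 0 x y z.
  by rewrite /quat_vec /x /y /z; congr Quat; congr (w _ _); apply: val_inj.
pose I : {poly C} := ('i%C)%:P.
have II : I * I = -1 by rewrite -polyCM -expr2 sqr_i polyCN.
pose g := x - I * y.
have gh : g * (x + I * y) = - (z ^+ 2).
  rewrite /g; transitivity (x ^+ 2 - (I * I) * y ^+ 2); first by ring.
  by rewrite II; move/eqP: iso; rewrite addrA addr_eq0 => /eqP <-; ring.
have ALAcE (a b : {poly C}) :
    ALAc (Quat a b 0 0) = Quat 0 (a ^+ 2 + b ^+ 2) (I * (a ^+ 2 - b ^+ 2)) (2 * I * a * b).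
  rewrite /ALAc /quat_map /quat_L /= polyC0 polyC1 -/I.
  by congr Quat => /=; ring.
(* If [g = 0], then [z = 0] and the curve is [x] times the vector [(1, -I, 0)], which the quaternion
   unit in position [q1] produces. *)
have [g0|g0] := eqVneq g 0.
  exists (Quat 0 1 0 0), x.
  have z0 : z = 0.
    by apply/eqP; rewrite -sqrf_eq0 -oppr_eq0 -gh g0 mul0r.
  have xE : x = I * y by apply/eqP; rewrite -subr_eq0 -/g g0.
  rewrite ALAcE /GRing.scale /= /quat_scale /= z0 xE; congr Quat; first by ring.
  - by ring.
  - transitivity (- (I * I) * y); last by ring.
    by rewrite II opprK mul1r.
  - by ring.
pose m := gcdp g z.
have m0 : m != 0 by rewrite gcdp_eq0 negb_and g0.
pose s := g %/ m; pose t := z %/ m.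
have gE : g = s * m by rewrite /s divpK // dvdp_gcdl.
have zE : z = t * m by rewrite /t divpK // dvdp_gcdr.
have cst : coprimep s t by apply: coprimep_div_gcd; rewrite g0.
have s0 : s != 0 by apply: contraNneq g0; rewrite gE => ->; rewrite mul0r.
have hE : s * (x + I * y) = - (t ^+ 2 * m).
  apply: (mulfI m0); transitivity (g * (x + I * y)); first by rewrite gE; ring.
  by rewrite gh zE; ring.
have /dvdpP [l mE] : s %| m.
  have : s %| t ^+ 2 * m.
    by rewrite -dvdpNr -hE dvdp_mulr.
  by rewrite Gauss_dvdpr // coprimep_expr.
have hE' : x + I * y = - (t ^+ 2 * l).
  by apply: (mulfI s0); rewrite hE mE; ring.
have gE' : x - I * y = s ^+ 2 * l by rewrite -/g gE mE; ring.
(* The values of [x + I * y] and [x - I * y] determine [x] and [y] up to a factor 2, which is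
   cancelled against the half [h]. *)
have two (p q : {poly C}) : p * 2 = q * 2 -> p = q.
  by apply: mulIf; rewrite -polyC_natr polyC_eq0 pnatr_eq0.
pose h : {poly C} := (2^-1)%:P.
have h2 : h * 2 = 1 by rewrite -polyC_natr -polyCM mulVf // pnatr_eq0.
exists (Quat (I * s) t 0 0), (- (h * l)).
rewrite ALAcE /GRing.scale /= /quat_scale /=; congr Quat.
- by ring.
- apply: two; transitivity ((x + I * y) + (x - I * y)); first by ring.
  rewrite hE' gE'.
  transitivity (- ((h * 2) * l * ((I * I) * s ^+ 2 + t ^+ 2))); last by ring.
  by rewrite h2 II; ring.
- apply: two; transitivity (- (I * I) * (2 * y)); first by rewrite II; ring.
  transitivity (- I * ((x + I * y) - (x - I * y))); first by ring.
  rewrite hE' gE'.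
  transitivity (- ((h * 2) * l * I * ((I * I) * s ^+ 2 - t ^+ 2))); last by ring.
  by rewrite h2 II; ring.
- rewrite zE mE; transitivity (- ((h * 2) * l * (I * I) * s * t)); last by ring.
  by rewrite h2 II; ring.
Qed.

End Isotropic.

(** * Formal derivations of polynomials in two variables *)

Section PolyDerivations.
Context {S : comNzRingType}.

Lemma inner_derivM (p q : {poly {poly S}}) :
  map_poly deriv (p * q) = map_poly deriv p * q + p * map_poly deriv q.
Proof.
apply/polyP => i; rewrite coefD !coefM coef_map /= coefM raddf_sum -big_split.
by apply: eq_bigr => j _; rewrite /= !coef_map /= derivM.
Qed.

Lemma inner_deriv_comm (p : {poly {poly S}}) :
  map_poly deriv p^`() = (map_poly deriv p)^`().
Proof. by apply/polyP => i; rewrite coef_map !coef_deriv coef_map /= raddfMn. Qed.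

(* The chain rule for a derivation [d]: on the coefficients, carried by [f],
   [d] acts as [e] followed by multiplication by [c]. *)
Lemma derivation_horner (T : comNzRingType) (f : {rmorphism S -> T})
    (e : {additive S -> S}) (d : {additive T -> T}) (c x : T) (p : {poly S}) :
  (forall a b, d (a * b) = d a * b + a * d b) ->
  (forall s, d (f s) = f (e s) * c) ->
  d (map_poly f p).[x] =
    (map_poly f p^`()).[x] * d x + (map_poly f (map_poly e p)).[x] * c.
Proof.
move=> dM df; elim/poly_ind: p => [|p s IH].
  by rewrite deriv0 !raddf0 !horner0 !raddf0 !mul0r addr0.
have eE : map_poly e (p * 'X + s%:P) = map_poly e p * 'X + (e s)%:P.
  apply/polyP => i; rewrite coef_map !coefD !coefMX !coefC /= raddfD /= coef_map.
  by congr (_ + _); case: ifP => //= _; rewrite raddf0.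
rewrite derivMXaddC eE !rmorphD !rmorphM /= !map_polyX !map_polyC /=.
rewrite !(hornerD, hornerMX, hornerC) raddfD /= dM df IH; ring.
Qed.

End PolyDerivations.

(** This is the chain rule with the identity on coefficients: the constant [w] contributes nothing,
    so freezing the outer variable commutes with differentiating in the inner one. *)
Lemma deriv_hornerC (S : comNzRingType) (p : {poly {poly S}}) (w : S) :
  (p.[w%:P])^`() = (map_poly deriv p).[w%:P].
Proof.
rewrite -[p in LHS](map_poly_id (g := idfun)) //.
rewrite (derivation_horner (f := idfun) (e := deriv) (d := deriv) (c := 1)).
- by rewrite /= derivC mulr0 add0r mulr1 map_poly_id.
- exact: derivM.
- by move=> s; rewrite mulr1.
Qed.

(** * Polynomials with vanishing Wronskian *)

Section Wronskian.
Context {S : idomainType}.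
Hypothesis charS : forall n, n.+1%:R != 0 :> S.
Implicit Types p q : {poly S}.

Lemma coefM_top p q m n : (size p <= m.+1)%N -> (size q <= n.+1)%N ->
  (p * q)`_(m + n) = p`_m * q`_n.
Proof.
move=> sp sq; have lm : (m < (m + n).+1)%N by rewrite ltnS leq_addr.
rewrite coefM (bigD1 (Ordinal lm)) //= addKn big1 ?addr0 // => j.
rewrite -val_eqE /= neq_ltn => /orP[jm|mj].
- by rewrite [q`__]nth_default ?mulr0 // (leq_trans sq) // ltn_subRL ltn_add2r.
- by rewrite nth_default ?mul0r // (leq_trans sp).
Qed.

(** The top coefficients of [X p' q] and [p X q'] are the product of the leading coefficients times
    the respective degrees, which therefore agree by [charS]. The factor [X] restores the degree
    lost by derivation. *)
Lemma wronskian_size p q : p != 0 -> q != 0 -> p^`() * q = p * q^`() ->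
  size p = size q.
Proof.
move=> p0 q0 pq.
have [m sm] : exists m, size p = m.+1 by exists (size p).-1; rewrite prednK // size_poly_gt0.
have [n sn] : exists n, size q = n.+1 by exists (size q).-1; rewrite prednK // size_poly_gt0.
have sX (r : {poly S}) k : size r = k.+1 -> (size ('X * r^`())%R <= k.+1)%N.
  move=> sr; apply/leq_sizeP => -[|j] // kj.
  by rewrite coefXM /= coef_deriv nth_default ?mul0rn // sr.
have cX (r : {poly S}) k : ('X * r^`())`_k = r`_k *+ k.
  by rewrite coefXM coef_deriv; case: k.
have : ('X * p^`() * q)`_(m + n) = (p * ('X * q^`()))`_(m + n).
  by rewrite -mulrA pq mulrCA.
rewrite !coefM_top ?sX ?sm ?sn // !cX.
have -> : p`_m = lead_coef p by rewrite lead_coefE sm.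
have -> : q`_n = lead_coef q by rewrite lead_coefE sn.
rewrite mulrnAl mulrnAr => mn; congr _.+1; apply/eqP.
have lpq : lead_coef p * lead_coef q != 0 by rewrite mulf_neq0 ?lead_coef_eq0.
have aux a b : (lead_coef p * lead_coef q) *+ (a + b.+1) != (lead_coef p * lead_coef q) *+ a.
  rewrite mulrnDr -subr_eq0 addrAC subrr add0r -mulr_natr mulf_neq0 //.
have [lt|lt|//] := ltngtP m n.
- by have := aux m (n - m.+1)%N; rewrite addnS -addSn subnKC // mn eqxx.
- by have := aux n (m - n.+1)%N; rewrite addnS -addSn subnKC // mn eqxx.
Qed.

(** The difference of the two sides again has zero Wronskian with [q]. If nonzero, it would have the
    size of [q], yet its coefficient at that degree cancels. *)
Lemma wronskian_lead_coef p q : q != 0 -> p^`() * q = p * q^`() ->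
  lead_coef q *: p = lead_coef p *: q.
Proof.
move=> q0 pq; have [->|p0] := eqVneq p 0.
  by rewrite lead_coef0 scaler0 scale0r.
have spq := wronskian_size p0 q0 pq.
apply/eqP; rewrite -subr_eq0; apply/negPn/negP; set m := _ - _ => m0.
have /wronskian_size : m^`() * q = m * q^`().
  by rewrite /m derivB !derivZ !mulrBl -!scalerAl pq (mulrC q).
move=> /(_ m0 q0) smq.
have /eqP : lead_coef m = 0.
  rewrite lead_coefE smq /m coefB !coefZ.
  have -> : p`_(size q).-1 = lead_coef p by rewrite -spq.
  by rewrite -lead_coefE mulrC subrr.
by rewrite lead_coef_eq0 (negPf m0).
Qed.

End Wronskian.

(** The [size p] equally spaced points strictly between [a] and [b] have distinct images under [f],
    and [p] has fewer roots than that. *)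
Lemma nonroot_itv (R : realFieldType) (S : idomainType) (f : R -> S) (p : {poly S}) (a b : R) :
  injective f -> p != 0 -> a < b -> exists2 x, a < x < b & p.[f x] != 0.
Proof.
move=> fI p0 ab; pose n := size p.
pose x k : R := a + (b - a) * (k.+1%:R / n.+1%:R).
have ab0 : 0 < b - a by rewrite subr_gt0.
have [/allPn[_ /mapP[k kn ->] pk]|pn] := boolP (~~ all (root p) [seq f (x k) | k <- iota 0 n]).
  exists (x k); last exact: pk.
  move: kn; rewrite mem_iota /= add0n => kn.
  rewrite /x ltrDl mulr_gt0 ?divr_gt0 ?ltr0n //= -ltrBrDl -[ltRHS]mulr1.
  by rewrite ltr_pM2l // ltr_pdivrMr ?ltr0n // mul1r ltr_nat ltnS.
have /(max_poly_roots p0 (negbNE pn)) : uniq [seq f (x k) | k <- iota 0 n].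
  rewrite map_inj_uniq ?iota_uniq // => i j /fI /addrI /(mulfI (lt0r_neq0 ab0)).
  by move=> /(mulIf (invr_neq0 (lt0r_neq0 (ltr0Sn R n)))) /eqP; rewrite eqr_nat => /eqP[].
by rewrite size_map size_iota ltnn.
Qed.

(** The first coordinate is chosen so that [P] stays a nonzero polynomial in the second variable. *)
Lemma eval2_nonzero_box (R : realType) (P : {poly {poly R}}) : P != 0 ->
  forall a b c d : R, a < b -> c < d ->
  exists p : R * R, [/\ a < p.1 < b, c < p.2 < d & eval2 P p != 0].
Proof.
move=> P0 a b c d ab cd.
have [u uab Pu] := nonroot_itv (@polyC_inj R) P0 ab.
have [v vcd Pv] := nonroot_itv (f := idfun) (fun _ _ => id) Pu cd.
by exists (u, v).
Qed.

(** * Wirtinger coordinates [z] and [w] *)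

Section Wirtinger.
Context {R : realType}.
Local Notation C := R[i].
Local Notation K := {poly {poly C}}.
Local Notation "p ^:v" := (map_poly deriv p) (at level 2, format "p ^:v").
Implicit Types (P Q H : {poly {poly R}}) (p : R * R).

(* Inverting [z = u + i v], [w = u - i v]; in [K], the inner indeterminate
   stands for [z] and the outer one for [w]. *)
Definition u_zw : K := (2^-1)%:P%:P * ('X%:P + 'X).
Definition v_zw : K := (- ('i%C / 2))%:P%:P * ('X%:P - 'X).

Definition zw_const : R -> K := polyC \o polyC \o real_complex R.
HB.instance Definition _ := GRing.RMorphism.on zw_const.

Definition zw_inner : {poly R} -> K :=
  horner_morph (fun a => mulrC v_zw (zw_const a)).
HB.instance Definition _ := GRing.RMorphism.on zw_inner.

Definition zw_subst : {poly {poly R}} -> K :=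
  horner_morph (fun q => mulrC u_zw (zw_inner q)).
HB.instance Definition _ := GRing.RMorphism.on zw_subst.

(** Stated for any derivation killing the constants, this covers both partial derivatives of [K], in
    [z] and in [w]. *)
Lemma zw_derivation (d : {additive K -> K}) H :
  (forall a b, d (a * b) = d a * b + a * d b) ->
  (forall a : C, d a%:P%:P = 0) ->
  d (zw_subst H) = zw_subst H^`() * d u_zw + zw_subst H^:v * d v_zw.
Proof.
move=> dM d0; apply: derivation_horner => // q.
rewrite (derivation_horner (e := \0) (c := 0)) ?mulr0 ?addr0 //.
by move=> a; rewrite mulr0; apply: d0.
Qed.

Let h : K := (2^-1)%:P%:P.
Let I : K := 'i%C%:P%:P.

Lemma v_zwE : v_zw = - (I * h * ('X%:P - 'X)).
Proof. by rewrite /v_zw /I /h !polyCN !polyCM mulNr. Qed.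

(** The Wirtinger derivative [(d_u - i d_v) / 2]: the derivatives of [u_zw] and [v_zw] in [z] are
    [h] and [- I * h]. *)
Lemma dz_zw_subst H :
  map_poly deriv (zw_subst H) = h * (zw_subst H^`() - I * zw_subst H^:v).
Proof.
have dzC (a : C) : map_poly deriv a%:P%:P = 0 :> K.
  by rewrite map_polyC /= derivC polyC0.
have dzZ : map_poly deriv 'X%:P = 1 :> K by rewrite map_polyC /= derivX polyC1.
have dzW : map_poly deriv 'X = 0 :> K.
  apply/polyP => i; rewrite coef_map coefX coef0 /=.
  by case: eqP => _; rewrite ?derivC.
rewrite zw_derivation //; last exact: inner_derivM.
rewrite v_zwE /u_zw -/h raddfN /= !inner_derivM raddfD raddfB /=.
rewrite dzZ dzW !dzC. ring.
Qed.

Lemma dw_zw_subst H :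
  (zw_subst H)^`() = h * (zw_subst H^`() + I * zw_subst H^:v).
Proof.
rewrite (zw_derivation (d := deriv)); last by move=> a; rewrite /= derivC.
- rewrite v_zwE /u_zw -/h /= !(derivM, derivD, derivN, derivX, derivC); ring.
- exact: derivM.
Qed.

(** The real plane is the locus where [w] is the conjugate of [z]; there the substitution recovers
    the real coordinates. *)
Lemma zw_subst_eval H p :
  (zw_subst H).[(conjc (toC p))%:P].[toC p] = (eval2 H p)%:C%C.
Proof.
case: p => u v; rewrite -[eval2 _ _]/(H.[u%:P].[v]).
set z := toC _.
have zE : z = u%:C%C + 'i%C * v%:C%C by rewrite [LHS]complexE.
have zcE : conjc z = u%:C%C - 'i%C * v%:C%C.
  by rewrite [LHS]complexE /= rmorphN mulrN.
clearbody z; have uE : u_zw.[(conjc z)%:P].[z] = u%:C%C.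
  by rewrite /u_zw !hornerE /= zcE zE; field.
have vE : v_zw.[(conjc z)%:P].[z] = v%:C%C.
  rewrite /v_zw !hornerE /= zcE zE.
  transitivity (- ('i%C ^+ 2) * v%:C%C : C); last by rewrite sqr_i opprK mul1r.
  by field.
have innerE (q : {poly R}) : (zw_inner q).[(conjc z)%:P].[z] = q.[v]%:C%C.
  elim/poly_ind: q => [|q c IH]; first by rewrite !raddf0 !horner0.
  rewrite rmorphD rmorphM !hornerE /= rmorphD rmorphM /= IH; congr (_ * _ + _).
  - by rewrite /zw_inner horner_morphX vE.
  - by rewrite /zw_inner horner_morphC !hornerE.
elim/poly_ind: H => [|q c IH]; first by rewrite !raddf0 !horner0.
rewrite rmorphD rmorphM !hornerE /= rmorphD rmorphM /= IH; congr (_ * _ + _).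
- by rewrite /zw_subst horner_morphX uE.
- by rewrite /zw_subst horner_morphC innerE.
Qed.

Lemma zw_subst_neq0 H : H != 0 -> zw_subst H != 0.
Proof.
move=> /eval2_nonzero_box /(_ 0 1 0 1 ltr01 ltr01) [p [_ _]].
apply: contra_neq => H0; apply: (@complexI R).
by rewrite -zw_subst_eval H0 !horner0.
Qed.

(** With [A / D] and [B / D] in the role of the partial derivatives in [u] and [v], the hypotheses
    are the Cauchy-Riemann equations for [(A - i B) / D] with denominators cleared; the conclusion
    says that its derivative in [w] vanishes. *)
Lemma zw_closed (A B D : {poly {poly R}}) :
  A^`() * D - A * D^`() + (B^:v * D - B * D^:v) = 0 ->
  A^:v * D - A * D^:v = B^`() * D - B * D^`() ->
  (zw_subst A - I * zw_subst B)^`() * zw_subst D =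
    (zw_subst A - I * zw_subst B) * (zw_subst D)^`().
Proof.
move=> harm curl; have I2 : I * I = -1 by rewrite /I -!polyCM -expr2 sqr_i !polyCN.
apply/eqP; rewrite -subr_eq0 derivB derivM [I^`()]derivC mul0r add0r.
rewrite !dw_zw_subst; apply/eqP.
transitivity (h * (zw_subst (A^`() * D - A * D^`() + (B^:v * D - B * D^:v)) +
   I * zw_subst ((A^:v * D - A * D^:v) - (B^`() * D - B * D^`())))); last first.
  by rewrite harm curl subrr rmorph0 !(mulr0, addr0).
rewrite !(rmorphD, rmorphN, rmorphM) /=.
transitivity (h * (zw_subst A^`() * zw_subst D + I * zw_subst A^:v * zw_subst D
  - I * zw_subst B^`() * zw_subst D - (I * I) * zw_subst B^:v * zw_subst D
  - (zw_subst A - I * zw_subst B) * zw_subst D^`()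
  - (I * zw_subst A - (I * I) * zw_subst B) * zw_subst D^:v)); first by ring.
by rewrite I2; ring.
Qed.

(* The Wirtinger derivative of [P / Q] with respect to [z] does not depend on
   [w]: it is obtained by freezing [w] at a constant [w0], and so it has the
   rational primitive [(P / Q) (z, w0)]. *)
Lemma harmonic_quotient_derivative P Q :
  let A := P^`() * Q - P * Q^`() in
  let B := P^:v * Q - P * Q^:v in
  let D := Q ^+ 2 in
  Q != 0 ->
  A^`() * D - A * D^`() + (B^:v * D - B * D^:v) = 0 ->
  exists f g : {poly C}, [/\ g != 0, Q = 1 -> g = 1 &
    forall p, ((eval2 A p)%:C%C - 'i%C * (eval2 B p)%:C%C) * g.[toC p] ^+ 2 =
      (eval2 D p)%:C%C * (f^`() * g - f * g^`()).[toC p]].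
Proof.
move=> A B D Q0 harm.
(* Symmetry of the mixed derivatives of [P / Q], a formal identity. *)
have curl : A^:v * D - A * D^:v = B^`() * D - B * D^`().
  rewrite /A /B /D expr2 !derivB !raddfB /= !derivM !inner_derivM !inner_deriv_comm.
  by ring.
pose N := zw_subst A - I * zw_subst B; pose E := zw_subst D.
have NE := zw_closed harm curl; rewrite -/N -/E in NE.
have E0 : E != 0 by rewrite zw_subst_neq0 // expf_neq0.
have charC n : n.+1%:R != 0 :> {poly C}.
  by rewrite -polyC_natr polyC_eq0 pnatr_eq0.
(* The Wronskian in [w] vanishes over the ring of polynomials in [z]: [N] and [E] are proportional,
   with factors depending on [z] only. *)
have lNE := wronskian_lead_coef charC E0 NE.
have [w0 _ Q0w] : exists2 x : R, 0 < x < 1 & (zw_subst Q).[x%:C%C%:P] != 0.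
  apply: (nonroot_itv (f := polyC \o real_complex R)) ltr01.
  - by move=> x y /= /polyC_inj /complexI.
  - exact: zw_subst_neq0.
move: (w0%:C%C) Q0w => {}w0 Q0w.
have sep : N * E.[w0%:P]%:P = N.[w0%:P]%:P * E.
  have l0 : lead_coef E != 0 by rewrite lead_coef_eq0.
  have /mulfI : (lead_coef E)%:P != 0 by rewrite polyC_eq0.
  apply; rewrite mulrA [_%:P * N]mul_polyC lNE -mul_polyC.
  have := congr1 (fun r => r.[w0%:P]) lNE; rewrite !hornerZ.
  by rewrite mulrA -polyCM => ->; rewrite polyCM; ring.
pose p1 := (zw_subst P).[w0%:P].
(* The primitive is doubled because the derivative in [z] is half of [d_u - i d_v]. *)
exists (p1 + p1), (zw_subst Q).[w0%:P]; split=> // [->|p].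
  by rewrite rmorph1 hornerE.
have -> : (p1 + p1)^`() * (zw_subst Q).[w0%:P] -
    (p1 + p1) * ((zw_subst Q).[w0%:P])^`() = N.[w0%:P].
  pose M := map_poly deriv (zw_subst P) * zw_subst Q -
            zw_subst P * map_poly deriv (zw_subst Q).
  have -> : N = M + M.
    have h2 : h + h = 1.
      by rewrite -!polyCD -[X in X + _]mul1r -[X in _ + X]mul1r -mulrDl mulfV // pnatr_eq0.
    rewrite /M !dz_zw_subst /N /A /B !rmorphB !rmorphM /=.
    by rewrite -[LHS]mul1r -[X in X * _ = _]h2; ring.
  rewrite derivD !deriv_hornerC /M !(hornerM, hornerD, hornerN) /p1; ring.
have := congr1 (fun r => r.[(conjc (toC p))%:P].[toC p]) sep.
have Ew : E.[w0%:P] = (zw_subst Q).[w0%:P] ^+ 2.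
  by rewrite /E /D rmorphXn /= horner_exp.
rewrite !hornerM !hornerC Ew horner_exp /E zw_subst_eval.
rewrite {1}/N !(hornerD, hornerN, hornerM) !zw_subst_eval /I !hornerC => ->.
by rewrite mulrC.
Qed.

End Wirtinger.

(** * Reduced fractions and residues of derivatives *)

Section ReducedFractions.
Context {F : fieldType}.
Implicit Types (phi : {fraction {poly F}}) (f g n d : {poly F}).

Lemma frac_repr phi :
  phi * tofrac (frac (repr phi)).2 = tofrac (frac (repr phi)).1.
Proof.
case: (repr phi) (reprK phi) => -[n d] /= d0 <-.
unlock FracField.tofrac; rewrite -[LHS]FracField.pi_mul.
apply/eqmodP; rewrite /= FracField.equivfE /FracField.mulf /=.
by rewrite !numden_Ratio ?oner_eq0 ?mulr1 //= mulrC.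
Qed.

Lemma ratf_coprime phi : coprimep (ratf_num phi) (ratf_den phi).
Proof. by apply: coprimep_div_gcd; rewrite denom_ratioP orbT. Qed.

Lemma ratf_numE phi : phi * tofrac (ratf_den phi) = tofrac (ratf_num phi).
Proof.
have := frac_repr phi; have := denom_ratioP (repr phi); rewrite /ratf_num /ratf_den.
move: (frac _).1 (frac _).2 => n d d0.
set m := gcdp n d; have m0 : tofrac m != 0.
  by rewrite tofrac_eq0 gcdp_eq0 negb_and d0 orbT.
have [nE dE] : n = n %/ m * m /\ d = d %/ m * m.
  by rewrite !divpK ?dvdp_gcdl ?dvdp_gcdr.
move: m m0 nE dE => m m0 {1}-> {1}->; rewrite !tofracM mulrA.
exact: (mulIf m0).
Qed.

Lemma ratf_num_den phi n d : phi * tofrac d = tofrac n ->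
  ratf_num phi * d = n * ratf_den phi.
Proof.
move=> phid; apply/eqP; rewrite -tofrac_eq !tofracM -ratf_numE -phid.
by apply/eqP; rewrite mulrAC.
Qed.

(** By coprimality the reduced denominator divides every denominator [d] of [phi]. *)
Lemma ratf_poleN phi n d a : phi * tofrac d = tofrac n -> d.[a] != 0 ->
  ~ ratf_pole phi a.
Proof.
move=> /ratf_num_den nd /negP da pole; apply: da.
have : ratf_den phi %| ratf_num phi * d by rewrite nd dvdp_mull.
rewrite Gauss_dvdpr; last by rewrite coprimep_sym ratf_coprime.
by move: pole; rewrite /ratf_pole -[_ == _]/(root d a) -!dvdp_XsubCl; apply: dvdp_trans.
Qed.

(* Subtracting [b / (z - a)^m] from [f / g], where [b] is the value of [f / g1]
   at [a], lowers the order of the pole; only the derivative of such a term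
   enters the principal part, and it contributes nothing to [1 / (z - a)]. *)
Lemma derivative_principal_part (a : F) m f g1 : g1.[a] != 0 ->
  exists c : nat -> F, c 0 = 0 /\
    forall phi, let g := ('X - a%:P) ^+ m * g1 in
      phi * tofrac g ^+ 2 = tofrac (f^`() * g - f * g^`()) ->
    exists n, (phi - \sum_(k < m.+1) tofrac (c k)%:P / tofrac ('X - a%:P) ^+ k.+1)
      * tofrac g1 ^+ 2 = tofrac n.
Proof.
move=> g1a; have t0 : tofrac ('X - a%:P) != 0 by rewrite tofrac_eq0 polyXsubC_eq0.
have g10 : tofrac g1 != 0.
  by rewrite tofrac_eq0; apply: contraNneq g1a => ->; rewrite horner0.
elim: m f => [|m IH] f.
  exists (fun=> 0); split=> // phi; rewrite expr0 mul1r => phiE.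
  exists (f^`() * g1 - f * g1^`()).
  by rewrite big_ord1 rmorph0 mul0r subr0.
pose b := f.[a] / g1.[a].
(* This splits [f / g] into [b / (z - a)^(m+1)] and [f1 / ((z - a)^m g1)]. *)
have /factor_theorem [f1 f1E] : root (f - b%:P * g1) a.
  by rewrite /root !hornerE divfK ?subrr.
have [c [c0 cE]] := IH f1.
(* Differentiating [b / (z - a)^(m+1)] gives [- (m+1) b / (z - a)^(m+2)], hence the entry of index
   [m.+1]; the entry 0 is never touched. *)
exists (fun k => if k == m.+1 then - (b *+ m.+1) else c k); split=> // phi g phiE.
pose psi := phi + tofrac (b *+ m.+1)%:P / tofrac ('X - a%:P) ^+ m.+2.
have [|n nE] := cE psi; last first.
  exists n; rewrite -nE; congr (_ * _); rewrite big_ord_recr /= eqxx /psi.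
  rewrite polyCN tofracN mulNr opprB addrA; congr (_ - _).
  by apply: eq_bigr => i _; rewrite ltn_eqF.
rewrite /psi.
pose t : {poly F} := 'X - a%:P; pose T := t ^+ m.
have t1 : t^`() = 1 by exact: derivXsubC.
have tT : t * T^`() = T *+ m.
  rewrite /T deriv_exp t1 mul1r; case: (m) => [|k] /=; first by rewrite mulr0.
  by rewrite mulrnAr -exprS.
have gE : g = t * T * g1 by rewrite /g exprS.
have fE : f = b%:P * g1 + f1 * t by rewrite -f1E addrC subrK.
(* The quotient rule for the splitting of [f / g], with denominators cleared. It is reduced to an
   identity in a general ring, where [tT] enters as a hypothesis. *)
have key : f^`() * g - f * g^`() + (b *+ m.+1)%:P * T * g1 ^+ 2 =
    t ^+ 2 * (f1^`() * (T * g1) - f1 * (T * g1)^`()).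
  have id (S : comNzRingType) (t' T' dT x dx y dy c' k : S) : t' * dT = T' * k ->
      (c' * dy + (dx * t' + x)) * (t' * T' * y)
      - (c' * y + x * t') * ((T' + t' * dT) * y + t' * T' * dy)
      + (c' + c' * k) * T' * y ^+ 2
      = t' ^+ 2 * (dx * (T' * y) - x * (dT * y + T' * dy)).
    move=> tk; transitivity (t' ^+ 2 * (dx * (T' * y) - x * (dT * y + T' * dy))
      + c' * y ^+ 2 * (T' * k - t' * dT)); first by ring.
    by rewrite tk; ring.
  have -> : g^`() = (T + t * T^`()) * g1 + t * T * g1^`().
    by rewrite gE 2!derivM t1 mul1r.
  have -> : f^`() = b%:P * g1^`() + (f1^`() * t + f1).
    by rewrite fE derivD 2!derivM t1 mulr1 derivC mul0r add0r.
  rewrite [in RHS]derivM gE fE mulrS polyCD polyCMn -[b%:P *+ m]mulr_natr.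
  by apply: id; rewrite tT mulr_natr.
have tm : tofrac ('X - a%:P) ^+ m.+2 = tofrac t ^+ 2 * tofrac T.
  by rewrite -addn2 exprD mulrC /T tofracXn.
have T0 : tofrac T != 0 by rewrite /T tofracXn; apply: expf_neq0; exact: t0.
rewrite tm -/t -/T; have {}t0 : tofrac t != 0 by exact: t0.
clear psi; clearbody T; clear tm t1 tT fE IH cE f1E; clearbody t g.
have step (K : fieldType) (x c' t' T' y : K) : t' != 0 -> T' != 0 ->
    (x + c' / (t' ^+ 2 * T')) * (T' * y) ^+ 2 * t' ^+ 2 =
    x * (t' * T' * y) ^+ 2 + c' * T' * y ^+ 2.
  by move=> ht hT; field; rewrite hT ht.
apply: (mulIf (expf_neq0 2 t0)).
rewrite [tofrac (T * g1)]tofracM (step _ _ _ _ _ _ t0 T0).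
have <- : tofrac g = tofrac t * tofrac T * tofrac g1 by rewrite gE !tofracM.
rewrite phiE -[tofrac g1 ^+ 2]tofracXn -[_ * tofrac T]tofracM -[_ * tofrac (g1 ^+ 2)]tofracM.
rewrite -tofracD key.
by rewrite [X in X = _]tofracM tofracXn mulrC.
Qed.

(** [phi] is the derivative of [f / g]. Once the full power of [z - a] is split off [g], the
    remaining denominator [g1 ^+ 2] is nonzero at [a], and the principal part has 0 as its first
    entry. *)
Lemma is_residue_derivative f g phi (a : F) : g != 0 ->
  phi * tofrac g ^+ 2 = tofrac (f^`() * g - f * g^`()) -> is_residue phi a 0.
Proof.
move=> g0 phiE; have [m [g1 g1a gE]] := multiplicity_XsubC g a.
have g1a0 : g1.[a] != 0 by rewrite g0 in g1a.
have [c [c0 cE]] := derivative_principal_part m f g1a0.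
rewrite mulrC in gE; move: phiE; rewrite gE => /cE[n nE].
exists (mkseq c m.+1); split; last by rewrite nth_mkseq.
apply: (@ratf_poleN _ n (g1 ^+ 2)); last by rewrite horner_exp expf_neq0.
rewrite tofracXn -nE; congr ((_ - _) * _).
rewrite /principal_part size_mkseq; apply: eq_bigr => k _.
by rewrite nth_mkseq.
Qed.

End ReducedFractions.

(** * Calculus on the plane *)

Section PlaneCalculus.
Context {R : realType}.
Implicit Types (Omega : set (R * R)) (x y : R * R -> R) (p : R * R).
Local Notation e1 := ((1, 0) : R * R).
Local Notation e2 := ((0, 1) : R * R).

Lemma open_box Omega p : open Omega -> Omega p -> exists2 e : R, 0 < e &
  forall q : R * R, p.1 - e < q.1 < p.1 + e -> p.2 - e < q.2 < p.2 + e -> Omega q.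
Proof.
move=> oO Op; have : nbhs p Omega by apply: open_nbhs_nbhs.
move=> /nbhs_ballP[e /= e0 eO].
exists e => // q /andP[q1 q2] /andP[q3 q4]; apply: eO.
by split; rewrite /ball /= ltr_norml; apply/andP; split; lra.
Qed.

(** [S] is dense, as it meets every box; a nonzero value of [x] would persist on a ball inside
    [Omega], which contains a point of [S]. *)
Lemma continuous_eq0_dense Omega x (S : R * R -> Prop) : open Omega ->
  (forall a b c d : R, a < b -> c < d ->
     exists q : R * R, [/\ a < q.1 < b, c < q.2 < d & S q]) ->
  (forall p, Omega p -> {for p, continuous x}) ->
  (forall p, Omega p -> S p -> x p = 0) -> forall p, Omega p -> x p = 0.
Proof.
move=> oO dS cx x0 p Op; apply/eqP/negPn/negP => xp.
have nx : nbhs p [set q | x q != 0].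
  exact: cvgr_neq0 (cx _ Op) xp.
have : nbhs p (Omega `&` [set q | x q != 0]).
  by apply: filterI nx; apply: open_nbhs_nbhs.
move=> /nbhs_ballP[e /= e0 eO].
have [||q [/andP[q1 q2] /andP[q3 q4] Sq]] := dS (p.1 - e) (p.1 + e) (p.2 - e) (p.2 + e).
- by lra.
- by lra.
have [|Oq /eqP] := eO q; last by apply; apply: x0.
by split; rewrite /ball /= ltr_norml; apply/andP; split; lra.
Qed.

Lemma is_derive_fst p (w : R * R) : is_derive p w (fst : R * R -> R) w.1.
Proof.
have d : differentiable (fst : R * R -> R) p.
  by apply: linear_differentiable => q; apply: cvg_fst.
apply: DeriveDef; first exact: diff_derivable.
rewrite deriveE // (diff_lin _ (f := fst)) //.
by move=> q; apply: cvg_fst.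
Qed.

Lemma is_derive_snd p (w : R * R) : is_derive p w (snd : R * R -> R) w.2.
Proof.
have d : differentiable (snd : R * R -> R) p.
  by apply: linear_differentiable => q; apply: cvg_snd.
apply: DeriveDef; first exact: diff_derivable.
rewrite deriveE // (diff_lin _ (f := snd)) //.
by move=> q; apply: cvg_snd.
Qed.

Lemma is_derive_eval2 (H : {poly {poly R}}) p (w : R * R) :
  is_derive p w (eval2 H) (eval2 H^`() p * w.1 + eval2 (map_poly deriv H) p * w.2).
Proof.
have inner (q : {poly R}) : is_derive p w (fun p : R * R => q.[p.2]) (q^`().[p.2] * w.2).
  elim/poly_ind: q => [|q c IH].
    rewrite deriv0 horner0 mul0r; under eq_fun do rewrite horner0.
    exact: is_derive_cst.
  under eq_fun do rewrite hornerMXaddC.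
  apply: is_derive_eq (is_deriveD (is_deriveM IH (is_derive_snd p w)) (is_derive_cst c p w)) _.
  rewrite derivMXaddC !hornerE /GRing.scale /=; ring.
elim/poly_ind: H => [|H c IH].
  rewrite !raddf0 /eval2 !horner0 !mul0r addr0; under eq_fun do rewrite !horner0.
  exact: is_derive_cst.
have -> : eval2 (H * 'X + c%:P) = fun p => eval2 H p * p.1 + c.[p.2].
  by apply/funext => q; rewrite /eval2 !hornerE.
apply: is_derive_eq (is_deriveD (is_deriveM IH (is_derive_fst p w)) (inner c)) _.
have dX : map_poly deriv 'X = 0 :> {poly {poly R}}.
  apply/polyP => i; rewrite coef_map coefX coef0 /=.
  by case: eqP => _; rewrite ?derivC.
have -> : map_poly deriv (H * 'X + c%:P) = map_poly deriv H * 'X + (c^`())%:P.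
  by rewrite raddfD /= inner_derivM dX mulr0 addr0 map_polyC.
rewrite derivMXaddC /eval2 !hornerE /GRing.scale /=; ring.
Qed.

Lemma continuous_eval2 (H : {poly {poly R}}) : continuous (eval2 H).
Proof.
move=> p; have inner (q : {poly R}) : {for p, continuous (fun p : R * R => q.[p.2])}.
  by apply: (continuous_comp (f := snd) (g := horner q)); [apply: cvg_snd | apply: continuous_horner].
elim/poly_ind: H => [|H c IH].
  have -> : eval2 (0 : {poly {poly R}}) = cst 0.
    by apply/funext => q; rewrite /eval2 !horner0.
  exact: cst_continuous.
have -> : eval2 (H * 'X + c%:P) = fun p => eval2 H p * p.1 + c.[p.2].
  by apply/funext => q; rewrite /eval2 !hornerE.
by apply: cvgD; [apply: cvgM => //; apply: cvg_fst | apply: inner].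
Qed.

End PlaneCalculus.

(** * Harmonicity of minimal surfaces in isothermal coordinates *)

Section Harmonicity.
Context {R : realType}.
Implicit Types (Omega : set (R * R)) (X : R * R -> 'rV[R]_3) (a b w : 'rV[R]_3).

Lemma dotpE a b : dotp a b = a ord0 0 * b ord0 0 + a ord0 1 * b ord0 1 +
  a ord0 2%:R * b ord0 2%:R.
Proof.
rewrite /dotp !big_ord_recl big_ord0 addr0 addrA.
by congr (a _ _ * b _ _ + a _ _ * b _ _ + a _ _ * b _ _); apply: val_inj.
Qed.

Lemma dotpDl a b w : dotp (a + b) w = dotp a w + dotp b w.
Proof. by rewrite !dotpE !mxE; ring. Qed.

Lemma dotpZr (k : R) a b : dotp a (k *: b) = k * dotp a b.
Proof. by rewrite !dotpE !mxE; ring. Qed.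

Lemma dotpC a b : dotp a b = dotp b a.
Proof. by rewrite !dotpE; ring. Qed.

Lemma dotp_eq0 a : dotp a a = 0 -> a = 0.
Proof.
move=> /eqP; rewrite /dotp psumr_eq0 => [/allP a0|l _]; last by rewrite -expr2 sqr_ge0.
apply/rowP => l; rewrite mxE; have := a0 l; rewrite mem_index_enum => /(_ isT).
by rewrite mulf_eq0 orbb => /eqP.
Qed.

Lemma crosspE a b : [/\ crossp a b ord0 0 = a ord0 1 * b ord0 2%:R - a ord0 2%:R * b ord0 1,
  crossp a b ord0 1 = a ord0 2%:R * b ord0 0 - a ord0 0 * b ord0 2%:R &
  crossp a b ord0 2%:R = a ord0 0 * b ord0 1 - a ord0 1 * b ord0 0].
Proof.
by split; rewrite mxE; congr (a _ _ * b _ _ - a _ _ * b _ _); apply: val_inj.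
Qed.

(** The squared determinant of [a], [b], [w] as a Gram determinant, expanded along its first row. *)
Lemma gram_dotp_crossp a b w : dotp w (crossp a b) ^+ 2 =
  dotp a a * (dotp b b * dotp w w - dotp b w ^+ 2)
  - dotp a b * (dotp a b * dotp w w - dotp b w * dotp a w)
  + dotp a w * (dotp a b * dotp b w - dotp b b * dotp a w).
Proof. by rewrite !dotpE; have [-> -> ->] := crosspE a b; ring. Qed.

Lemma dotp_crossp a b :
  dotp (crossp a b) (crossp a b) = dotp a a * dotp b b - dotp a b ^+ 2.
Proof. by rewrite !dotpE; have [-> -> ->] := crosspE a b; ring. Qed.

(** The Gram determinant reduces to the product of the three squared norms, and it is zero. *)
Lemma orthogonal_frame_eq0 a b w : 0 < dotp a a -> 0 < dotp b b -> dotp a b = 0 ->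
  dotp a w = 0 -> dotp b w = 0 -> dotp w (crossp a b) = 0 -> w = 0.
Proof.
move=> a0 b0 ab aw bw nw; apply: dotp_eq0.
have := gram_dotp_crossp a b w; rewrite nw ab aw bw expr0n /= !(mulr0, mul0r, subr0, addr0).
by move/esym/eqP; rewrite !mulf_eq0 (gt_eqF a0) (gt_eqF b0) => /eqP.
Qed.

Lemma is_derive_coord (Y : R * R -> 'rV[R]_3) (p v : R * R) l :
  differentiable Y p -> is_derive p v (fun q => Y q ord0 l) ('D_v Y p ord0 l).
Proof.
move=> dY; have /derivable_mxP /(_ ord0 l) dYl := @diff_derivable _ _ _ Y p v dY.
by rewrite derive_mx ?mxE; [exact: derivableP | exact: diff_derivable].
Qed.

Lemma derive_dotp (Y Z : R * R -> 'rV[R]_3) (p v : R * R) :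
  differentiable Y p -> differentiable Z p ->
  'D_v (fun q => dotp (Y q) (Z q)) p = dotp ('D_v Y p) (Z p) + dotp (Y p) ('D_v Z p).
Proof.
move=> dY dZ; have -> : (fun q => dotp (Y q) (Z q)) = fun q => Y q ord0 0 * Z q ord0 0 +
    Y q ord0 1 * Z q ord0 1 + Y q ord0 2%:R * Z q ord0 2%:R.
  by apply/funext => q; rewrite dotpE.
have d l := is_deriveM (is_derive_coord v l dY) (is_derive_coord v l dZ).
have [_ ->] := is_deriveD (is_deriveD (d 0) (d 1)) (d 2%:R).
by rewrite !dotpE /GRing.scale /=; ring.
Qed.

Lemma open_near Omega p (P : R * R -> Prop) : open Omega -> Omega p ->
  (forall q, Omega q -> P q) -> \near p, P p.
Proof.
move=> oO Op OP; apply: (@filterS _ (nbhs p) _ Omega P OP).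
exact: open_nbhs_nbhs.
Qed.

Lemma conformal_derive Omega (Y Z : R * R -> 'rV[R]_3) (p v : R * R) :
  open Omega -> Omega p -> differentiable Y p -> differentiable Z p ->
  (forall q, Omega q -> dotp (Y q) (Y q) = dotp (Z q) (Z q)) ->
  (forall q, Omega q -> dotp (Y q) (Z q) = 0) ->
  dotp ('D_v Y p) (Y p) = dotp ('D_v Z p) (Z p) /\
  dotp ('D_v Y p) (Z p) + dotp (Y p) ('D_v Z p) = 0.
Proof.
move=> oO Op dY dZ YZ YZ0; split.
  have := near_eq_derive v (open_near oO Op YZ).
  by rewrite !derive_dotp // ![dotp _ ('D_v _ _)]dotpC; lra.
by rewrite -derive_dotp // (near_eq_derive v (open_near oO Op YZ0)) derive_cst.
Qed.

(** Here [a], [b] stand for the first derivatives and [uu], [m], [vv] for the second ones. The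
    differentiated conformality relations make [uu + vv] orthogonal to [a] and [b]; vanishing mean
    curvature then removes its normal component. *)
Lemma conformal_mean_curvature0 (a b uu m vv : 'rV[R]_3) :
  let n := (norm2 (crossp a b))^-1 *: crossp a b in
  dotp a a = dotp b b -> 0 < dotp a a -> dotp a b = 0 ->
  dotp uu a = dotp m b -> dotp uu b + dotp a m = 0 ->
  dotp m a = dotp vv b -> dotp m b + dotp a vv = 0 ->
  (dotp uu n * dotp b b - 2%:R * dotp m n * dotp a b + dotp vv n * dotp a a) /
    (2%:R * (dotp a a * dotp b b - dotp a b ^+ 2)) = 0 ->
  uu + vv = 0.
Proof.
move=> n ab a0 ab0 Eu Fu Ev Fv H0; have b0 := a0; rewrite ab in b0.
have c0 : 0 < dotp (crossp a b) (crossp a b).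
  by rewrite dotp_crossp ab0 expr0n subr0 mulr_gt0.
apply: (orthogonal_frame_eq0 a0 b0 ab0).
- by rewrite dotpC dotpDl Eu [dotp vv a]dotpC.
- by rewrite dotpC dotpDl -Ev [dotp m a]dotpC.
move: H0; rewrite /n /norm2 -ab ab0 !dotpZr.
set k := (Num.sqrt _)^-1; have k0 : k != 0.
  by rewrite invr_eq0 sqrtr_eq0 -ltNge.
clearbody k; rewrite dotpDl mulr0 subr0 -mulrDl -mulrDr expr0n subr0 => /eqP.
by rewrite !mulf_eq0 invr_eq0 !mulf_eq0 pnatr_eq0 (gt_eqF a0) (negPf k0) /= !orbF => /eqP.
Qed.

(** Symmetry of the second derivatives is assumed at [p] only; for quotients it is read off their
    closed forms. *)
Lemma minimal_harmonic Omega X p : open Omega -> smooth_on Omega X ->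
  isothermal Omega X -> minimal Omega X -> Omega p ->
  Dv (Du X) p = Du (Dv X) p -> Du (Du X) p + Dv (Dv X) p = 0.
Proof.
move=> oO sX iX mX Op mixed.
have dU : differentiable (Du X) p := sX [:: true] p Op.
have dV : differentiable (Dv X) p := sX [:: false] p Op.
have YZ q Oq := let: And3 h _ _ := iX q Oq in h.
have YZ0 q Oq := let: And3 _ _ h := iX q Oq in h.
have [Eu Fu] := conformal_derive (1, 0) oO Op dU dV YZ YZ0.
have [Ev Fv] := conformal_derive (0, 1) oO Op dU dV YZ YZ0.
have [Epos E0 F0] := iX p Op.
have Eu' : dotp (Du (Du X) p) (Du X p) = dotp (Dv (Du X) p) (Dv X p) by rewrite mixed; exact: Eu.
have Fu' : dotp (Du (Du X) p) (Dv X p) + dotp (Du X p) (Dv (Du X) p) = 0.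
  by rewrite mixed; exact: Fu.
exact: conformal_mean_curvature0 Epos E0 F0 Eu' Fu' Ev Fv (mX p Op).
Qed.

End Harmonicity.

(** * Identities extended by density, and the quotient rule *)

Section HolomorphicDerivative.
Context {R : realType}.
Local Notation C := R[i].
Implicit Types (Omega : set (R * R)) (X : R * R -> 'rV[R]_3) (p : R * R).
Local Notation "p ^:v" := (map_poly deriv p) (at level 2, format "p ^:v").

(** Multiplication by [z] mixes the real and imaginary parts, so a single induction carries both. *)
Lemma continuous_ReIm_horner (g : {poly C}) :
  continuous (fun p : R * R => complex.Re g.[toC p]) /\
  continuous (fun p : R * R => complex.Im g.[toC p]).
Proof.
elim/poly_ind: g => [|g c [cRe cIm]].
  by split=> p; under eq_fun do rewrite horner0; apply: cst_continuous.
have c1 : continuous (fst : R * R -> R) by move=> p; apply: cvg_fst.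
have c2 : continuous (snd : R * R -> R) by move=> p; apply: cvg_snd.
have -> : (fun p : R * R => complex.Re (g * 'X + c%:P).[toC p]) = fun p =>
    complex.Re g.[toC p] * p.1 - complex.Im g.[toC p] * p.2 + complex.Re c.
  apply/funext => p; rewrite hornerMXaddC.
  by case: c => ? ?; case: (g.[_]) => ? ?.
have -> : (fun p : R * R => complex.Im (g * 'X + c%:P).[toC p]) = fun p =>
    complex.Re g.[toC p] * p.2 + complex.Im g.[toC p] * p.1 + complex.Im c.
  apply/funext => p; rewrite hornerMXaddC.
  by case: c => ? ?; case: (g.[_]) => ? ?.
split=> p; apply: cvgD; try exact: cvg_cst.
- by apply: cvgB; apply: cvgM; [apply: cRe | apply: c1 | apply: cIm | apply: c2].
- by apply: cvgD; apply: cvgM; [apply: cRe | apply: c2 | apply: cIm | apply: c1].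
Qed.

Lemma horner_eq_dense Omega (a b : R * R -> R) (G W : {poly C}) (S : R * R -> Prop) :
  open Omega ->
  (forall a b c d : R, a < b -> c < d ->
     exists q : R * R, [/\ a < q.1 < b, c < q.2 < d & S q]) ->
  (forall p, Omega p -> {for p, continuous a}) ->
  (forall p, Omega p -> {for p, continuous b}) ->
  (forall p, Omega p -> S p -> (a p -i* b p)%C * G.[toC p] = W.[toC p]) ->
  forall p, Omega p -> (a p -i* b p)%C * G.[toC p] = W.[toC p].
Proof.
move=> oO dS ca cb GW p Op.
have [cReG cImG] := continuous_ReIm_horner G.
have [cReW cImW] := continuous_ReIm_horner W.
have re0 := @continuous_eq0_dense R Omega (fun p => a p * complex.Re G.[toC p] +
  b p * complex.Im G.[toC p] - complex.Re W.[toC p]) S oO dS.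
have im0 := @continuous_eq0_dense R Omega (fun p => a p * complex.Im G.[toC p] -
  b p * complex.Re G.[toC p] - complex.Im W.[toC p]) S oO dS.
suff [] : a p * complex.Re G.[toC p] + b p * complex.Im G.[toC p] - complex.Re W.[toC p] = 0 /\
    a p * complex.Im G.[toC p] - b p * complex.Re G.[toC p] - complex.Im W.[toC p] = 0.
  case: (G.[_]) (W.[_]) => x y [z t] /= h1 h2.
  by apply/eqP; rewrite eq_complex /=; apply/andP; split; apply/eqP; lra.
split; [apply: re0 | apply: im0] => // q Oq.
- apply: cvgB; last exact: cReW.
  by apply: cvgD; apply: cvgM; [exact: ca | exact: cReG | exact: cb | exact: cImG].
- move=> Sq; have := GW q Oq Sq; case: (G.[_]) (W.[_]) => x y [z t] /= [<- _]; ring.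
- apply: cvgB; last exact: cImW.
  by apply: cvgB; apply: cvgM; [exact: ca | exact: cImG | exact: cb | exact: cReG].
- move=> Sq; have := GW q Oq Sq; case: (G.[_]) (W.[_]) => x y [z t] /= [_ <-]; ring.
Qed.

(** Differentiating [x E = N] and multiplying by [E] lets [x E] be replaced by [N], so that no
    division occurs. *)
Lemma quotient_derive Omega (x dx : R * R -> R) (w : R * R)
    (d : {poly {poly R}} -> {poly {poly R}}) (N E : {poly {poly R}}) :
  open Omega ->
  (forall H p, is_derive p w (eval2 H) (eval2 (d H) p)) ->
  (forall p, Omega p -> is_derive p w x (dx p)) ->
  (forall p, Omega p -> x p * eval2 E p = eval2 N p) ->
  forall p, Omega p -> dx p * eval2 (E ^+ 2) p = eval2 (d N * E - N * d E) p.
Proof.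
move=> oO dE dX xE p Op.
have eM (H K : {poly {poly R}}) : eval2 (H * K) p = eval2 H p * eval2 K p.
  by rewrite /eval2 !hornerM.
have eB (H K : {poly {poly R}}) : eval2 (H - K) p = eval2 H p - eval2 K p.
  by rewrite /eval2 !(hornerD, hornerN).
have [_ dxE] := is_deriveM (dX p Op) (dE E p).
have := near_eq_derive w (open_near oO Op xE).
rewrite dxE; have [_ ->] := dE N p; rewrite /GRing.scale /= => dN.
rewrite expr2 eB !eM -dN -xE //; ring.
Qed.

End HolomorphicDerivative.

(** * The holomorphic derivative of a rational minimal surface *)

Section RationalMinimal.
Context {R : realType}.
Local Notation C := R[i].
Implicit Types (Omega : set (R * R)) (X Y : R * R -> 'rV[R]_3) (p : R * R).
Implicit Types (P Q N E : {poly {poly R}}).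
Local Notation "p ^:v" := (map_poly deriv p) (at level 2, format "p ^:v").

Lemma complex_scaleE (a b c : R) :
  c%:C%C * (a -i* b)%C = (a * c)%:C%C - 'i%C * (b * c)%:C%C.
Proof. by apply/eqP; rewrite eq_complex /=; apply/andP; split; apply/eqP; ring. Qed.

Lemma is_derive_eval2_u N p : is_derive p (1, 0) (eval2 N) (eval2 N^`() p).
Proof. by apply: is_derive_eq (is_derive_eval2 N p _) _; rewrite mulr1 mulr0 addr0. Qed.

Lemma is_derive_eval2_v N p : is_derive p (0, 1) (eval2 N) (eval2 N^:v p).
Proof. by apply: is_derive_eq (is_derive_eval2 N p _) _; rewrite mulr1 mulr0 add0r. Qed.

(** [Y] is arbitrary so that the rule can be iterated, from [X] to its first derivatives and from
    these to the second ones. *)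
Lemma coord_quotient_derive Omega Y N E l : open Omega ->
  (forall p, Omega p -> differentiable Y p) ->
  (forall p, Omega p -> Y p ord0 l * eval2 E p = eval2 N p) ->
  (forall p, Omega p ->
    Du Y p ord0 l * eval2 (E ^+ 2) p = eval2 (N^`() * E - N * E^`()) p) /\
  (forall p, Omega p ->
    Dv Y p ord0 l * eval2 (E ^+ 2) p = eval2 (N^:v * E - N * E^:v) p).
Proof.
move=> oO dY YE; split.
  apply: (quotient_derive (x := fun q => Y q ord0 l) (d := deriv) oO is_derive_eval2_u _ YE).
  by move=> p Op; apply: is_derive_coord; apply: dY.
apply: (quotient_derive (x := fun q => Y q ord0 l) (d := map_poly deriv) oO is_derive_eval2_v _ YE).
by move=> p Op; apply: is_derive_coord; apply: dY.
Qed.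

Lemma continuous_coord Y p l : differentiable Y p ->
  {for p, continuous (fun q => Y q ord0 l)}.
Proof.
move=> /differentiable_continuous cY.
apply: (continuous_comp (f := Y) (g := fun M : 'rV[R]_3 => M ord0 l)) => //.
exact: coord_continuous.
Qed.

Lemma quotient_coordE Omega Y P Q l : open Omega -> Q != 0 ->
  (forall p, Omega p -> differentiable Y p) ->
  (forall p, Omega p -> eval2 Q p != 0 -> Y p ord0 l = eval2 P p / eval2 Q p) ->
  forall p, Omega p -> Y p ord0 l * eval2 Q p = eval2 P p.
Proof.
move=> oO Q0 dY YE p Op; apply/eqP; rewrite -subr_eq0; apply/eqP.
apply: (continuous_eq0_dense (x := fun q => Y q ord0 l * eval2 Q q - eval2 P q)
  oO (eval2_nonzero_box Q0)) Op => q Oq.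
  apply: cvgB; last exact: continuous_eval2.
  by apply: cvgM; [apply: continuous_coord; apply: dY | apply: continuous_eval2].
by move=> Qq; rewrite YE // divfK // subrr.
Qed.

(* At the points where no denominator vanishes, the closed forms of the mixed
   second derivatives agree; harmonicity there already gives the polynomial
   identity. *)
Lemma minimal_quotient_harmonic Omega X (P Q : 'I_3 -> {poly {poly R}}) :
  domain Omega -> smooth_on Omega X -> isothermal Omega X -> minimal Omega X ->
  (forall l, Q l != 0) ->
  (forall l p, Omega p -> X p ord0 l * eval2 (Q l) p = eval2 (P l) p) ->
  forall l,
  let A := (P l)^`() * Q l - P l * (Q l)^`() in
  let B := (P l)^:v * Q l - P l * (Q l)^:v in
  let D := Q l ^+ 2 in
  A^`() * D - A * D^`() + (B^:v * D - B * D^:v) = 0.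
Proof.
move=> [oO _ [p0 Op0]] sX iX mX Q0 XE.
pose A l := (P l)^`() * Q l - P l * (Q l)^`().
pose B l := (P l)^:v * Q l - P l * (Q l)^:v.
pose D l := Q l ^+ 2.
have dX p Op : differentiable X p := sX [::] p Op.
have dU p Op : differentiable (Du X) p := sX [:: true] p Op.
have dV p Op : differentiable (Dv X) p := sX [:: false] p Op.
have harmonic p (Op : Omega p) := minimal_harmonic oO sX iX mX Op.
clear sX iX mX; move=> l; rewrite -/(A l) -/(B l) -/(D l); cbv zeta.
apply/eqP/negPn/negP; set h := (X in X != 0) => h0.
have [e e0 boxO] := open_box oO Op0.
(* All three denominators are included because symmetry of the mixed derivatives is needed in every
   coordinate. *)
have hQ0 : h * (Q 0 * (Q 1 * Q 2%:R)) != 0 by rewrite !mulf_neq0.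
have [||q [q1 q2]] := eval2_nonzero_box hQ0 (a := p0.1 - e) (b := p0.1 + e)
  (c := p0.2 - e) (d := p0.2 + e); [lra | lra |].
have evM (H K : {poly {poly R}}) : eval2 (H * K) q = eval2 H q * eval2 K q.
  by rewrite /eval2 !hornerM.
have evD (H K : {poly {poly R}}) : eval2 (H + K) q = eval2 H q + eval2 K q.
  by rewrite /eval2 !hornerD.
have Oq := boxO q q1 q2.
rewrite !evM => hQq.
have Qq k : eval2 (Q k) q != 0.
  move: hQq; rewrite !mulf_eq0 !negb_or => /and4P[_ Qq0 Qq1 Qq2].
  by case: k => -[|[|[|//]]] lt3; [move: Qq0 | move: Qq1 | move: Qq2];
    congr (eval2 (Q _) q != 0); apply: val_inj.
have Dq k : eval2 (D k ^+ 2) q != 0 by rewrite /D !expr2 !evM !mulf_neq0.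
have first k := coord_quotient_derive oO dX (XE k).
have secondU k := coord_quotient_derive oO dU (first k).1.
have secondV k := coord_quotient_derive oO dV (first k).2.
(* Both sides have the denominator [D k ^+ 2], and their numerators agree formally. *)
have mixed : Dv (Du X) q = Du (Dv X) q.
  apply/rowP => k; apply: (mulIf (Dq k)).
  apply: etrans ((secondU k).2 q Oq) _; apply: etrans (esym ((secondV k).1 q Oq)).
  congr (eval2 _ q).
  by rewrite !derivB !raddfB /= !expr2 !derivM !inner_derivM !inner_deriv_comm; ring.
have w0 : Du (Du X) q ord0 l + Dv (Dv X) q ord0 l = 0.
  by have := congr1 (fun M : 'rV[R]_3 => M ord0 l) (harmonic q Oq mixed); rewrite !mxE.
have hq : eval2 h q = 0.
  apply: etrans (evD _ _) _.
  apply: etrans (congr2 +%R (esym ((secondU l).1 q Oq)) (esym ((secondV l).2 q Oq))) _.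
  by rewrite -mulrDl w0 mul0r.
by move: hQq; rewrite hq mul0r eqxx.
Qed.

(** The identity with the derivative of [f / g] is obtained where [Q l] does not vanish, then
    everywhere by density. The clause on [g] serves polynomial surfaces, whose denominators are
    1. *)
Lemma minimal_quotient_derivative Omega X (P Q : 'I_3 -> {poly {poly R}}) :
  domain Omega -> smooth_on Omega X -> isothermal Omega X -> minimal Omega X ->
  (forall l, Q l != 0) ->
  (forall l p, Omega p -> eval2 (Q l) p != 0 ->
     X p ord0 l = eval2 (P l) p / eval2 (Q l) p) ->
  forall l, exists f g : {poly C}, [/\ g != 0, Q l = 1 -> g = 1 &
    forall p, Omega p -> (Du X p ord0 l -i* Dv X p ord0 l)%C * (g ^+ 2).[toC p] =
      (f^`() * g - f * g^`()).[toC p]].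
Proof.
move=> dO sX iX mX Q0 XE l; have [oO _ _] := dO.
have dX p Op : differentiable X p := sX [::] p Op.
have dU p Op : differentiable (Du X) p := sX [:: true] p Op.
have dV p Op : differentiable (Dv X) p := sX [:: false] p Op.
have XE' k := quotient_coordE oO (Q0 k) dX (XE k).
have harm := minimal_quotient_harmonic dO sX iX mX Q0 XE' l.
clear sX iX mX dO.
have [f [g [g0 g1 fgE]]] := harmonic_quotient_derivative (Q0 l) harm.
exists f, g; split=> //.
have [Eu Ev] := coord_quotient_derive oO dX (XE' l).
apply: (horner_eq_dense (a := fun p => Du X p ord0 l) (b := fun p => Dv X p ord0 l)
  oO (eval2_nonzero_box (Q0 l))).
- by move=> p Op; apply: continuous_coord; apply: dU.
- by move=> p Op; apply: continuous_coord; apply: dV.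
move=> p Op Qp; have Dp : (eval2 (Q l ^+ 2) p)%:C%C != 0.
  by rewrite fmorph_eq0 expr2 /eval2 !hornerM mulf_neq0.
apply: (mulfI Dp); rewrite -fgE -Eu // -Ev // horner_exp mulrA; congr (_ * _).
exact: complex_scaleE.
Qed.

End RationalMinimal.

(** * The fundamental theorem of calculus on a subdivision *)

Section PiecewiseFTC.
Context {R : realType}.
Local Notation mu := (@lebesgue_measure R).
Implicit Types (F f g h : R -> R) (a b c : R).

Lemma integrable_itv_oo_cc h a b : mu.-integrable `]a, b[ (EFin \o h) ->
  mu.-integrable `[a, b] (EFin \o h).
Proof.
move=> /integrableP[mh ih]; apply/integrableP; split.
  have [ab|ba|ab] := ltgtP a b.
  - by apply/emeasurable_fun_itv_obnd_cbndP/emeasurable_fun_itv_bndo_bndcP.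
  - by rewrite set_itv_ge -?ltNge ?bnd_simp //; apply: measurable_fun_set0.
  - by rewrite ab set_itv1; apply: measurable_fun_set1.
rewrite integral_itv_bndoo //; exact: measurableT_comp.
Qed.

(** [h] is prescribed only inside the interval, since a curve may have corners at the end points;
    these form a null set. *)
Lemma FTC2_oo F h a b g : a < b -> {within `[a, b], continuous F} ->
  {within `[a, b], continuous g} ->
  (forall t, t \in `]a, b[ -> is_derive t 1 F (g t)) ->
  (forall t, t \in `]a, b[ -> h t = g t) ->
  mu.-integrable `[a, b] (EFin \o h) /\ Rintegral mu `[a, b] h = F b - F a.
Proof.
move=> ab cF cg dF hg.
have ig : mu.-integrable `[a, b] (EFin \o g).
  by apply: continuous_compact_integrable => //; apply: segment_compact.
have igo : mu.-integrable `]a, b[ (EFin \o g).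
  by apply: integrableS ig => //; apply: subset_itv_oo_cc.
have iho : mu.-integrable `]a, b[ (EFin \o h).
  by apply: eq_integrable igo => // t; rewrite inE => /= tab; rewrite hg.
split; first exact: integrable_itv_oo_cc.
have /integrableP[mh _] := iho; have /integrableP[mg _] := igo.
rewrite /Rintegral integral_itv_bndoo //.
have -> : (\int[mu]_(z in `]a, b[) (h z)%:E = \int[mu]_(z in `]a, b[) (g z)%:E)%E.
  by apply: eq_integral => t; rewrite inE => /= tab; rewrite hg.
rewrite -(@integral_itv_bndoo _ _ _ _ true false) //.
have [_ Fa Fb] := (continuous_within_itvP F ab).1 cF.
rewrite (continuous_FTC2 ab cg (F := F)) //.
- by split=> // t tab; have [] := dF t tab.
- by move=> t tab; rewrite derive1E; have [] := dF t tab.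
Qed.

(** The second interval is opened at [b] to make the union disjoint; a single point is
    negligible. *)
Lemma integrable_itv_cat h a b c : a <= b -> b <= c ->
  mu.-integrable `[a, b] (EFin \o h) -> mu.-integrable `[b, c] (EFin \o h) ->
  mu.-integrable `[a, c] (EFin \o h) /\
  Rintegral mu `[a, c] h = Rintegral mu `[a, b] h + Rintegral mu `[b, c] h.
Proof.
move=> ab bc iab ibc.
have ibc' : mu.-integrable `]b, c] (EFin \o h).
  by apply: integrableS ibc => //; apply: subset_itv_oc_cc.
have iac : mu.-integrable `[a, c] (EFin \o h).
  rewrite (@itv_bndbnd_setU _ _ _ (BRight b)) ?bnd_simp //.
  have /integrableP[mab fab] := iab; have /integrableP[mbc fbc] := ibc'.
  have mabc : measurable_fun (`[a, b] `|` `]b, c]) (EFin \o h).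
    by apply/measurable_funU.
  apply/integrableP; split=> //.
  rewrite ge0_integral_setU //; first exact: lte_add_pinfty.
  - exact: measurableT_comp.
  - apply/disj_setPS => t [/=]; rewrite !in_itv /= => /andP[_ tb] /andP[].
    by rewrite ltNge tb.
split=> //; have := Rintegral_itvB iac (x := b).
rewrite !bnd_simp => /(_ ab bc); rewrite Rintegral_itv_obnd_cbnd // => <-.
by rewrite addrC subrK.
Qed.

Lemma path_lt_last a (s : seq R) : path <%R a s -> a <= last a s.
Proof.
move=> /(order_path_min lt_trans) /allP minb.
by case: s minb => [//|d s] /= minb; exact/ltW/minb/mem_last.
Qed.

Lemma path_lt_nth a (s : seq R) k : path <%R a s -> (k < size s)%N ->
  [/\ a <= (a :: s)`_k, (a :: s)`_k < s`_k & s`_k <= last a s].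
Proof.
elim: s a k => [//|b s IH] a [|k] /= /andP[ab bs] ks.
  by split=> //; apply: path_lt_last.
have [h1 h2 h3] := IH b k bs ks.
by split=> //; apply: le_trans h1; apply: ltW.
Qed.

(** Induction on the subdivision with a moving start [a]; the increments of [F] telescope. *)
Lemma piecewise_FTC2 F h (s : seq R) a : path <%R a s ->
  {within `[a, last a s], continuous F} ->
  (forall k, (k < size s)%N -> exists2 g : R -> R,
     {within `[(a :: s)`_k, s`_k], continuous g} &
     forall t, t \in `](a :: s)`_k, s`_k[ -> is_derive t 1 F (g t) /\ h t = g t) ->
  mu.-integrable `[a, last a s] (EFin \o h) /\
  Rintegral mu `[a, last a s] h = F (last a s) - F a.
Proof.
elim: s a => [|b s IH] a /=.
  move=> _ _ _; rewrite set_itv1 Rintegral_set1 subrr; split=> //.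
  apply: null_set_integrable => //; first exact: measurable_fun_set1.
  exact: lebesgue_measure_set1.
move=> /andP[ab bs] cF pieces.
have bl := path_lt_last bs.
have [g cg dg] := pieces 0 isT.
have cab : {within `[a, b], continuous F}.
  by apply: continuous_subspaceW cF; apply: subset_itvl; rewrite bnd_simp.
have cbl : {within `[b, last b s], continuous F}.
  by apply: continuous_subspaceW cF; apply: subset_itvr; rewrite bnd_simp ltW.
have [iab eab] : mu.-integrable `[a, b] (EFin \o h) /\ Rintegral mu `[a, b] h = F b - F a.
  by apply: (FTC2_oo ab cab cg) => t tab; have [] := dg t tab.
have [ibc ebc] := IH b bs cbl (fun k ks => pieces k.+1 ks).
have [iac eac] := integrable_itv_cat (ltW ab) bl iab ibc.
by split=> //; rewrite eac eab ebc addrC subrKA.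
Qed.

End PiecewiseFTC.

(** * Contour integrals *)

Section ContourIntegral.
Context {R : realType}.
Implicit Types (Omega : set (R * R)) (X : R * R -> 'rV[R]_3) (p : R * R).
Implicit Types (gamma : R -> R * R) (x : R * R -> R).

Lemma is_derive_along x gamma (t : R) (v : R * R) : differentiable x (gamma t) ->
  is_derive t 1 gamma v ->
  is_derive t 1 (x \o gamma)
    ('D_(1, 0) x (gamma t) * v.1 + 'D_(0, 1) x (gamma t) * v.2).
Proof.
move=> dx [dg <-]; have dg' : differentiable gamma t by apply/derivable1_diffP.
have dxg : differentiable (x \o gamma) t by apply: differentiable_comp.
apply: DeriveDef; first exact/derivable1_diffP.
rewrite !deriveE // diff_comp //=; set w := 'd gamma t 1.
have -> : w = w.1 *: ((1, 0) : R * R) + w.2 *: ((0, 1) : R * R).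
  by case: w => a b; congr (_, _); rewrite /= /GRing.scale /=; ring.
rewrite linearD !linearZ /= /GRing.scale /=; ring.
Qed.

Lemma within_continuous_comp (A : set R) gamma x :
  {within A, continuous gamma} -> (forall t, A t -> {for gamma t, continuous x}) ->
  {within A, continuous (x \o gamma)}.
Proof.
move=> /subspace_continuousP cg cx; apply/subspace_continuousP => t At.
by apply: cvg_comp (cg t At) _; apply: cx.
Qed.

Lemma within_continuousD (A : set R) (f g : R -> R) : {within A, continuous f} ->
  {within A, continuous g} -> {within A, continuous (fun t => f t + g t)}.
Proof.
move=> /subspace_continuousP cf /subspace_continuousP cg.
by apply/subspace_continuousP => t At; apply: cvgD; [apply: cf | apply: cg].
Qed.

Lemma within_continuousM (A : set R) (f g : R -> R) : {within A, continuous f} ->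
  {within A, continuous g} -> {within A, continuous (fun t => f t * g t)}.
Proof.
move=> /subspace_continuousP cf /subspace_continuousP cg.
by apply/subspace_continuousP => t At; apply: cvgM; [apply: cf | apply: cg].
Qed.

(** [x \o gamma] is a primitive of [h] inside every piece, and the continuous extension given by
    [C1_on] takes the place of the derivative of [gamma] at the break points. *)
Lemma integral_along_curve Omega x xu xv gamma (h : R -> R) :
  (forall p, Omega p -> differentiable x p) ->
  (forall p, Omega p -> 'D_(1, 0) x p = xu p) ->
  (forall p, Omega p -> 'D_(0, 1) x p = xv p) ->
  (forall p, Omega p -> {for p, continuous xu}) ->
  (forall p, Omega p -> {for p, continuous xv}) ->
  piecewise_C1 gamma -> curve_in Omega gamma ->
  (forall t, t \in `[0, 1] -> h t = xu (gamma t) * ('D_1 gamma t).1 +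
                                  xv (gamma t) * ('D_1 gamma t).2) ->
  Rintegral lebesgue_measure `[0, 1] h = x (gamma 1) - x (gamma 0).
Proof.
move=> dx xuE xvE cxu cxv [cg [s [s01 l1 C1]]] [_ gO] hE.
have cx p : Omega p -> {for p, continuous x}.
  by move=> Op; apply: differentiable_continuous; apply: dx.
have [] := @piecewise_FTC2 R (x \o gamma) h s 0 s01; rewrite ?l1 //.
  by apply: within_continuous_comp => // t t01; apply: cx; apply: gO.
move=> k ks; have [h0 h1 h2] := path_lt_nth s01 ks; rewrite l1 in h2.
have sub t : t \in `[(0 :: s)`_k, s`_k] -> t \in `[0, 1].
  rewrite !in_itv /= => /andP[t0 t1].
  by rewrite (le_trans h0 t0) (le_trans t1 h2).
have [g [cgg dg]] := C1 k ks.
have cgk : {within `[(0 :: s)`_k, s`_k], continuous gamma}.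
  by apply: continuous_subspaceW cg => t /= /sub.
exists (fun t => xu (gamma t) * (g t).1 + xv (gamma t) * (g t).2).
  apply: within_continuousD; apply: within_continuousM.
  - by apply: (within_continuous_comp (x := xu)) cgk _ => t /sub /gO; apply: cxu.
  - by apply: (within_continuous_comp (x := fst)) cgg _ => t _; apply: cvg_fst.
  - by apply: (within_continuous_comp (x := xv)) cgk _ => t /sub /gO; apply: cxv.
  - by apply: (within_continuous_comp (x := snd)) cgg _ => t _; apply: cvg_snd.
move=> t tk; have t01 : t \in `[0, 1] by apply/sub/subset_itv_oo_cc.
have Ot := gO t t01; split.
  rewrite -(xuE _ Ot) -(xvE _ Ot).
  exact: is_derive_along (dx _ Ot) (dg t tk).
by rewrite hE //; have [_ ->] := dg t tk.
Qed.

(** The real part of [Phi dz] is the differential of [X], so the constant is [X z0]. *)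
Lemma real_part_of_integralP Omega X (Phi : 'I_3 -> R[i] -> R[i]) :
  smooth_on Omega X ->
  (forall l p, Omega p -> Phi l (toC p) = (Du X p ord0 l -i* Dv X p ord0 l)%C) ->
  real_part_of_integral Omega X Phi.
Proof.
move=> sX PhiE z0 Oz0; exists (X z0) => z gamma Oz [C1 _ gO g0 g1].
have dX p (Op : Omega p) : differentiable X p := sX [::] p Op.
have dU p (Op : Omega p) : differentiable (Du X) p := sX [:: true] p Op.
have dV p (Op : Omega p) : differentiable (Dv X) p := sX [:: false] p Op.
clear sX; apply/rowP => l; rewrite !mxE /contour_integral.
rewrite -[complex.Re (_ +i* _)%C]/(Rintegral _ _ _).
apply: etrans (esym (addrNK (X z0 ord0 l) _)) _; rewrite addrC; congr (_ + _).
rewrite -g0 -g1; apply: esym.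
apply: (integral_along_curve (x := fun q => X q ord0 l) (xu := fun q => Du X q ord0 l)
  (xv := fun q => Dv X q ord0 l) _ _ _ _ _ C1 gO).
- move=> p /dX dXp.
  apply: (differentiable_comp (f := X) (g := fun M : 'rV[R]_3 => M ord0 l)) => //.
  exact: differentiable_coord.
- by move=> p /dX dXp; have [_ ->] := is_derive_coord (1, 0) l dXp.
- by move=> p /dX dXp; have [_ ->] := is_derive_coord (0, 1) l dXp.
- by move=> p /dU; apply: continuous_coord.
- by move=> p /dV; apply: continuous_coord.
move=> t /(gO.2 t) Ot; rewrite PhiE //=; ring.
Qed.

End ContourIntegral.

(** * Complex polynomials and rational functions on a plane domain *)

Section ComplexPolynomialsOnThePlane.
Context {R : realType}.
Local Notation C := R[i].

Lemma horner_toC_nonzero_box (H : {poly C}) : H != 0 ->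
  forall a b c d : R, a < b -> c < d ->
  exists q : R * R, [/\ a < q.1 < b, c < q.2 < d & H.[toC q] != 0].
Proof.
move=> H0 a b c d ab cd; pose v := (c + d) / 2.
have [|u uab Hu] := nonroot_itv (f := fun x : R => (x +i* v)%C) _ H0 ab.
  by move=> x y [].
by exists (u, v); split=> //=; rewrite /v; apply/andP; split; lra.
Qed.

Lemma poly_eq0_on_domain (Omega : set (R * R)) (H : {poly C}) : domain Omega ->
  (forall p, Omega p -> H.[toC p] = 0) -> H = 0.
Proof.
move=> [oO _ [p Op]] HO; apply/eqP/negPn/negP => H0.
have [e e0 eO] := open_box oO Op.
have [||q [q1 q2 /eqP]] := horner_toC_nonzero_box H0 (a := p.1 - e)
  (b := p.1 + e) (c := p.2 - e) (d := p.2 + e); [lra | lra |].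
by apply; apply: HO; apply: eO.
Qed.

(** By density the reduced numerator and denominator satisfy the same identity as [W] and [G]. A
    zero of the denominator in [Omega] would then be one of the numerator, against coprimality. *)
Lemma ratf_eval_dense Omega (a b : R * R -> R) (G W : {poly C}) (phi : {fraction {poly C}}) :
  open Omega -> G != 0 -> phi * tofrac G = tofrac W ->
  (forall p, Omega p -> {for p, continuous a}) ->
  (forall p, Omega p -> {for p, continuous b}) ->
  (forall p, Omega p -> (a p -i* b p)%C * G.[toC p] = W.[toC p]) ->
  forall p, Omega p ->
    ~ ratf_pole phi (toC p) /\ ratf_eval phi (toC p) = (a p -i* b p)%C.
Proof.
move=> oO G0 phiE ca cb GW p Op.
have nd := ratf_num_den phiE.
have numE : (a p -i* b p)%C * (ratf_den phi).[toC p] = (ratf_num phi).[toC p].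
  apply: (horner_eq_dense oO (horner_toC_nonzero_box G0) ca cb) Op => q Oq Gq.
  apply: (mulIf Gq); rewrite -[RHS]hornerM nd hornerM -GW //; ring.
have den0 : (ratf_den phi).[toC p] != 0.
  apply/negP => den0; have := coprimep_root (ratf_coprime phi).
  by move=> /(_ (toC p)); rewrite /root -numE (eqP den0) mulr0 eqxx => /(_ isT).
by split; [apply/negP | rewrite /ratf_eval -numE mulfK].
Qed.

End ComplexPolynomialsOnThePlane.

(** The sum of the squares of the components of [X_u - i X_v] has real part [|X_u|^2 - |X_v|^2] and
    imaginary part [-2 <X_u, X_v>]. Hence the sum of the squares of [W] vanishes on [Omega], and so
    as a polynomial. *)
Lemma isothermal_isotropic (R : realType) (Omega : set (R * R))
    (X : R * R -> 'rV[R]_3) (G : {poly R[i]}) (W : 'rV[{poly R[i]}]_3) :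
  domain Omega -> isothermal Omega X ->
  (forall l p, Omega p ->
    (Du X p ord0 l -i* Dv X p ord0 l)%C * G.[toC p] = (W ord0 l).[toC p]) ->
  isotropic W.
Proof.
move=> dO iX GW; apply: (poly_eq0_on_domain dO) => p Op.
have [E _ F] := iX p Op; clear iX dO.
rewrite horner_sum; under eq_bigr => l _ do rewrite horner_exp -(GW l p Op) exprMn.
rewrite -mulr_suml; move: E F; rewrite /dotp.
move: (Du X p) (Dv X p) => a b E F.
suff -> : \sum_(l < 3) (a ord0 l -i* b ord0 l)%C ^+ 2 = 0 :> R[i] by rewrite mul0r.
have -> : \sum_(l < 3) (a ord0 l -i* b ord0 l)%C ^+ 2 =
    ((\sum_(l < 3) a ord0 l * a ord0 l - \sum_(l < 3) b ord0 l * b ord0 l) +i*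
     (- (2 * \sum_(l < 3) a ord0 l * b ord0 l)))%C :> R[i].
  rewrite !big_ord_recl !big_ord0; apply/eqP; rewrite eq_complex expr2 /=.
  by apply/andP; split; apply/eqP; ring.
by rewrite E F subrr mulr0 oppr0.
Qed.

(** * The representation in the polynomial and the rational case *)

Unset Implicit Arguments.

Theorem theorem4p3 (R : realType) (Omega : set (R * R))
    (X : R * R -> 'rV[R]_3) :
  domain Omega -> simply_connected Omega ->
  smooth_on Omega X -> isothermal Omega X -> minimal Omega X ->
  (polynomial_surface Omega X ->
     exists (A : quat {poly R[i]}) (lambda : {poly R[i]})
            (Phi : 'rV[{poly R[i]}]_3),
       [/\ quat_vec Phi = lambda *: ALAc A,
           isotropic Phi &
           real_part_of_integral Omega X (fun l z => (Phi ord0 l).[z])]) /\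
  (rational_surface Omega X ->
     exists (A : quat {poly R[i]}) (lambda : {fraction {poly R[i]}})
            (Phi : 'rV[{fraction {poly R[i]}}]_3),
       [/\ quat_vec Phi = lambda *: quat_map (fun p => tofrac p) (ALAc A),
           isotropic Phi,
           (forall (l : 'I_3) (a : R[i]), is_residue (Phi ord0 l) a 0),
           (forall (l : 'I_3) (p : R * R),
              Omega p -> ~ ratf_pole (Phi ord0 l) (toC p)) &
           real_part_of_integral Omega X
             (fun l z => ratf_eval (Phi ord0 l) z)]).
Proof.
move=> dO _ sX iX mX; split=> [/choice[P XP] | /choice[P] /choice[Q] XPQ].
  (* Polynomial components are quotients with denominator 1, for which [g = 1] and [Phi] is the
     derivative of the polynomial [f]. *)
  have Q0 (l : 'I_3) : 1 != 0 :> {poly {poly R}} by apply: oner_neq0.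
  have XE l p : Omega p -> eval2 1 p != 0 -> X p ord0 l = eval2 (P l) p / eval2 1 p.
    by move=> Op _; rewrite XP // /eval2 !hornerE divr1.
  have /choice[f fE] : forall l, exists f : {poly R[i]}, forall p, Omega p ->
      (Du X p ord0 l -i* Dv X p ord0 l)%C * (1 : {poly R[i]}).[toC p] = f^`().[toC p].
    move=> l; have [f [g [_ /(_ erefl) -> fE]]] :=
      minimal_quotient_derivative (Q := fun=> 1) dO sX iX mX Q0 XE l.
    exists f => p Op; have := fE p Op.
    by rewrite expr1n mulr1 derivC mulr0 subr0.
  pose Phi := \row_l (f l)^`().
  have PhiE l p : Omega p ->
      (Du X p ord0 l -i* Dv X p ord0 l)%C * (1 : {poly R[i]}).[toC p] = (Phi ord0 l).[toC p].
    by move=> Op; rewrite fE // mxE.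
  have isoPhi := isothermal_isotropic dO iX PhiE.
  have [A [lambda PhiA]] := isotropic_ALAc isoPhi.
  exists A, lambda, Phi; split=> //.
  apply: real_part_of_integralP => // l p Op.
  by rewrite -PhiE // hornerE mulr1.
have Q0 l : Q l != 0 := (XPQ l).1.
have [oO _ _] := dO.
have /choice[f /choice[g fgE]] := minimal_quotient_derivative dO sX iX mX Q0 (fun l => (XPQ l).2).
pose G l := g l ^+ 2; pose W l := (f l)^`() * g l - f l * (g l)^`().
have G0 l : G l != 0 by rewrite expf_neq0 //; have [] := fgE l.
have GW l p : Omega p -> (Du X p ord0 l -i* Dv X p ord0 l)%C * (G l).[toC p] = (W l).[toC p].
  by have [_ _] := fgE l; apply.
pose Phi : 'rV[{fraction {poly R[i]}}]_3 := \row_l (tofrac (W l) / tofrac (G l)).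
have PhiG l : Phi ord0 l * tofrac (G l) = tofrac (W l).
  by rewrite mxE divfK // tofrac_eq0.
(* [W l / G l] is the derivative of [f l / g l]. *)
have resPhi l a : is_residue (Phi ord0 l) a 0.
  have [g0 _ _] := fgE l.
  by apply: (is_residue_derivative a g0); rewrite -tofracXn; apply: PhiG.
clearbody Phi; clearbody G W.
(* A common denominator turns [Phi] into a polynomial curve [N], to which the factorization applies;
   [D] is afterwards absorbed into the scalar factor. *)
pose D := \prod_l G l; pose D' l := \prod_(k | k != l) G k.
pose N : 'rV[{poly R[i]}]_3 := \row_l (W l * D' l).
have DE l : D = G l * D' l by rewrite /D (bigD1 l).
have D0 : tofrac D != 0 by rewrite tofrac_eq0; apply/prodf_neq0.
clearbody D D'.
have NE l : N ord0 l = W l * D' l by rewrite mxE.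
have PhiN l : Phi ord0 l = tofrac (N ord0 l) / tofrac D.
  by rewrite NE [tofrac (_ * _)]tofracM -PhiG -[_ * _ * tofrac (D' l)]mulrA -tofracM -DE mulfK.
have isoN : isotropic N.
  apply: (isothermal_isotropic (G := D) dO iX) => l p Op.
  by rewrite NE (DE l) !hornerM mulrA GW.
have [A [lambda NA]] := isotropic_ALAc isoN.
(* Continuity of the first derivatives of [X] excludes poles of [Phi] in [Omega]. *)
have PhiP l p (Op : Omega p) := ratf_eval_dense oO (G0 l) (PhiG l)
  (fun q Oq => @continuous_coord R _ q l (sX [:: true] q Oq))
  (fun q Oq => @continuous_coord R _ q l (sX [:: false] q Oq)) (GW l) Op.
exists A, (tofrac lambda / tofrac D), Phi; split.
- have [[[N0 N1] N2] N3] := (congr1 (@q0 _) NA, congr1 (@q1 _) NA,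
                           congr1 (@q2 _) NA, congr1 (@q3 _) NA).
  rewrite /quat_vec !PhiN; move: N0 N1 N2 N3; rewrite /GRing.scale /= /quat_scale /quat_map /=.
  move=> N0 -> -> ->.
  by congr Quat; rewrite ?[tofrac lambda / _ * _]mulrAC -tofracM // -N0 tofrac0 mul0r.
- rewrite /isotropic; under eq_bigr => l _ do rewrite PhiN exprMn -tofracXn.
  by rewrite -mulr_suml -raddf_sum [\sum_(l < 3) _]isoN raddf0 mul0r.
- exact: resPhi.
- by move=> l p Op; have [] := PhiP l p Op.
- by apply: real_part_of_integralP => // l p Op; have [] := PhiP l p Op.
Qed.
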